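(* Consider the step system for linear oscillators, $V_i(q_i)=\frac12\omega_i^2q_i^2$ with constants $\omega_i>0$ ($i=1,2$), and let $h>h^{step,LO}=\frac12(\omega_1^2(q_1^{wall})^2+\omega_2^2(q_2^{wall})^2)$. For $(e_1,h-e_1)\in\mathcal{R}^c(h)$ put $$\theta_i^{wall,LO}(e_i;q_i^{wall})=\arccos\frac{\omega_iq_i^{wall}}{\sqrt{2e_i}}\in(0,\pi),\qquad \Theta_2^{LO}(e_1)=2\frac{\omega_2}{\omega_1}\arccos\frac{\omega_1q_1^{wall}}{\sqrt{2e_1}},\qquad \chi_2^{LO}(e_1,h)=\frac{\omega_2}{\omega_1}\,\frac{\pi-\arccos\frac{\omega_1q_1^{wall}}{\sqrt{2e_1}}}{\arccos\frac{\omega_2q_2^{wall}}{\sqrt{2(h-e_1)}}}.$$ (1) The flow on each level set $(e_1,h-e_1)\in\mathcal{R}^c(h)$ is topologically conjugated to the directional billiard flow in the fixed direction $(\omega_1,\omega_2)$ on the L-shaped billiard $L(\pi,\pi,\theta_1^{wall,LO}(e_1;q_1^{wall}),\theta_2^{wall,LO}(h-e_1;q_2^{wall}))$. (2) The widths of the arms of the L, $\theta_1^{wall,LO}(e_1;q_1^{wall})$ and $\theta_2^{wall,LO}(h-e_1;q_2^{wall})$, depend smoothly and monotonically on their arguments, and (as functions of $e_1$) are of opposite monotonicity if and only if $q_1^{wall}q_2^{wall}>0$. (3) The return map of the flow on the level set $(e_1,h-e_1)\in\mathcal{R}^c(h)$ to the section $\Sigma_1=\{p_1=0,\dot p_1<0\}$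 is an interval exchange map of the form $$F(\theta_2)=\begin{cases}\theta_2+\Theta_2 & \theta_2\in J_R\\ \theta_2+\Theta_2+2\theta_2^{wall}\{\chi_2\}+2\pi K_2 & \theta_2\in J_{K_2}\\ \theta_2+\Theta_2+2\theta_2^{wall}(-1+\{\chi_2\})+2\pi(K_2+1) & \theta_2\in J_{K_2+1}\end{cases}\pmod{2\pi}$$ with $(\theta_2^{wall},\Theta_2,\chi_2)=(\theta_2^{wall,LO}(h-e_1;q_2^{wall}),\Theta_2^{LO}(e_1),\chi_2^{LO}(e_1,h))$ and $K_2=\lfloor\chi_2\rfloor$.
   Context: System. $H=H_1+H_2$, $H_i=\frac{p_i^2}{2}+V_i(q_i)$. Step: $S=\{(q_1,q_2): q_1<q_1^{wall}\text{ and }q_2<q_2^{wall}\}$, $q_1^{wall}q_2^{wall}\neq0$. The step system is the Hamiltonian flow of $H$ on $(q_1,q_2)\in\mathbb{R}^2\setminus S$ with elastic reflections: on the 1-boundary ($q_1=q_1^{wall}$, $q_2<q_2^{wall}$) $p_1\to-p_1$, and on the 2-boundary ($q_1<q_1^{wall}$, $q_2=q_2^{wall}$) $p_2\to-p_2$; trajectories reaching the corner of the step stop. The energies $e_i=H_i$ are conserved; the level set $(e_1,e_2)$ is $\{q\in\mathbb{R}^2\setminus S,\ H_i(q_i,p_i)=e_i\}$, glued at the boundary by the impact rule. $h_i^{step}=V_i(q_i^{wall})=\frac12\omega_i^2(q_i^{wall})^2$, and $\mathcal{R}^c(h)=\{(e_1,e_2): e_1\in(h_1^{step},h-h_2^{step}),\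 e_2=h-e_1\}$. $\theta_2$ is the angle variable of the oscillator $H_2$ ($\dot\theta_2=\omega_2$ in the smooth motion), with phase $\theta_2=0$ on $\{p_2=0,\dot p_2<0\}$; on a fixed level set it parametrizes the circle $\Sigma_1$. $L(\pi,\pi,a,b)$, $0<a,b<\pi$, is the L-shaped table $\{(x_1,x_2)\in[0,\pi]^2: x_1\le a\text{ or }x_2\le b\}$. The directional billiard flow in direction $(\omega_1,\omega_2)$ is the motion with velocities in $\{(\pm\omega_1,\pm\omega_2)\}$ with elastic reflection at the sides; orbits reaching the reentrant corner stop. Intervals of the exchange map. $\{x\}$ is the fractional part. $J_R,J_{K_2},J_{K_2+1}$ are consecutive intervals, in this cyclic order, partitioning the $\theta_2$-circle $\mathbb{R}/2\pi\mathbb{Z}$, of lengths $2\pi-2\theta_2^{wall}$, $2\theta_2^{wall}(1-\{\chi_2\})$, $2\theta_2^{wall}\{\chi_2\}$ respectively, with the left end point of $J_R$ at $\theta_2^{wall}-\frac12\Theta_2$ (mod $2\pi$). *)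

(* Defs.v *)
From HB Require Import structures.
From mathcomp Require Import all_boot all_order all_algebra.
From mathcomp Require Import generic_quotient.
From mathcomp Require Import all_classical all_reals all_analysis.

Set Implicit Arguments.
Unset Strict Implicit.
Unset Printing Implicit Defensive.

Import Order.TTheory GRing.Theory Num.Theory.
Import numFieldNormedType.Exports.

Local Open Scope classical_set_scope.
Local Open Scope ring_scope.
Local Open Scope quotient_scope.

(* A phase point is ((q1, q2), (p1, p2)). *)
Notation phase R := ((R * R) * (R * R))%type.

(* Unit-mass motion q_i' = p_i, p_i' = force_i(q_i), staying in [level], with
   p_i -> - p_i on [side_i]; orbits that reach [corner] stop there. *)
Record impact_system (R : realType) := ImpactSystem {
  level : set (phase R);
  force1 : R -> R;
  force2 : R -> R;
  side1 : set (R * R);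
  side2 : set (R * R);
  corner : R * R }.

Section Glueing.
Variables (R : realType) (S : impact_system R).

Definition glued (z w : phase R) : Prop :=
  [/\ z.1 = w.1,
      w.2.1 = z.2.1 \/ side1 S z.1 /\ w.2.1 = - z.2.1 &
      w.2.2 = z.2.2 \/ side2 S z.1 /\ w.2.2 = - z.2.2].

Definition glue (z w : set_type (level S)) : bool :=
  `[< glued (set_val z) (set_val w) >].

Lemma glue_refl : reflexive glue.
Proof. by move=> z; apply/asboolP; split=> //; left. Qed.

Lemma glued_sym z w : glued z w -> glued w z.
Proof.
move=> [e h1 h2]; split; first by rewrite e.
- by case: h1 => [->|[s ->]]; [left | right; rewrite -e opprK].
- by case: h2 => [->|[s ->]]; [left | right; rewrite -e opprK].
Qed.

Lemma glue_sym : symmetric glue.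
Proof. by move=> z w; apply/asboolP/asboolP; exact: glued_sym. Qed.

Lemma glue_trans : transitive glue.
Proof.
move=> w z v /asboolP[e h1 h2] /asboolP[e' h1' h2'].
apply/asboolP; split; first by rewrite e.
- case: h1 h1' => [->|[s ->]] [->|[s' ->]]; first by left.
  + by right; rewrite e.
  + by right.
  + by left; rewrite opprK.
- case: h2 h2' => [->|[s ->]] [->|[s' ->]]; first by left.
  + by right; rewrite e.
  + by right.
  + by left; rewrite opprK.
Qed.

Canonical glue_equiv := EquivRel glue glue_refl glue_sym glue_trans.

(* The level set glued by the reflection rule, with the quotient topology. *)
Definition glued_level : topologicalType :=
  quotient_topology {eq_quot glue_equiv}.

Definition glued_class (z : set_type (level S)) : glued_level :=
  \pi_({eq_quot glue_equiv}) z.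

(* One degree of freedom (q, p) on [0, T]; [hit] is the set of times spent on
   the reflecting side.  The momentum is right-continuous: its value at an
   impact time is the outgoing one, its left limit the incoming one. *)
Definition elastic_coordinate (T : R) (f : R -> R) (hit : set R)
    (q p : R -> R) : Prop :=
  [/\ {within `[0, T], continuous q},
      (forall t, 0 < t < T -> ~ hit t ->
         is_derive t 1 q (p t) /\ is_derive t 1 p (f (q t))),
      (forall t, 0 <= t < T -> p s @[s --> t^'+] --> p t),
      (forall t, 0 < t <= T -> ~ hit t -> p s @[s --> t^'-] --> p t) &
      (forall t, 0 < t <= T -> hit t -> p s @[s --> t^'-] --> - p t)].

Definition trajectory (T : R) (z : R -> phase R) : Prop :=
  [/\ (forall t, 0 <= t <= T -> level S (z t)),
      (forall t, 0 <= t < T -> (z t).1 <> corner S),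
      elastic_coordinate T (force1 S) [set t | side1 S (z t).1]
        (fun t => (z t).1.1) (fun t => (z t).2.1) &
      elastic_coordinate T (force2 S) [set t | side2 S (z t).1]
        (fun t => (z t).1.2) (fun t => (z t).2.2)].

(* The partially defined flow, as a relation: x is carried to y in time t >= 0
   (negative times are the converse relation). *)
Definition flow (t : R) (x y : glued_level) : Prop :=
  0 <= t /\ exists (z : R -> phase R) (a b : set_type (level S)),
    [/\ trajectory t z,
        z 0 = set_val a, glued_class a = x,
        z t = set_val b & glued_class b = y].

Definition first_return (Sigma : set (phase R)) (z w : phase R) : Prop :=
  exists (T : R) (c : R -> phase R),
    [/\ 0 < T, trajectory T c,
        c 0 = z /\ Sigma z, c T = w /\ Sigma w &
        forall t, 0 < t < T -> ~ Sigma (c t)].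

End Glueing.

Definition topologically_conjugated (R : realType) (X Y : topologicalType)
    (phi : R -> X -> X -> Prop) (psi : R -> Y -> Y -> Prop) : Prop :=
  exists (f : X -> Y) (g : Y -> X),
    [/\ continuous f, continuous g, cancel f g, cancel g f &
        forall t x y, phi t x y <-> psi t (f x) (f y)].

Section Step.
Variable R : realType.
Implicit Types (w e q p h x : R).

Definition oscillatorV w q : R := w ^+ 2 * q ^+ 2 / 2.

Definition oscillatorH w q p : R := p ^+ 2 / 2 + oscillatorV w q.

Definition step (q1wall q2wall : R) : set (R * R) :=
  [set q | q.1 < q1wall /\ q.2 < q2wall].

Definition step_level (w1 w2 q1wall q2wall e1 e2 : R) : set (phase R) :=
  [set z | [/\ (~` step q1wall q2wall) z.1,
               oscillatorH w1 z.1.1 z.2.1 = e1 &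
               oscillatorH w2 z.1.2 z.2.2 = e2]].

(* The two boundary segments are taken closed, so that the glueing identifies
   the four phase points over the corner; the dynamics is unaffected, since
   orbits stop at the corner. *)
Definition step_system (w1 w2 q1wall q2wall e1 e2 : R) : impact_system R :=
  {| level := step_level w1 w2 q1wall q2wall e1 e2;
     force1 := fun q => - derive1 (oscillatorV w1) q;
     force2 := fun q => - derive1 (oscillatorV w2) q;
     side1 := [set q | q.1 = q1wall /\ q.2 <= q2wall];
     side2 := [set q | q.1 <= q1wall /\ q.2 = q2wall];
     corner := (q1wall, q2wall) |}.

Definition hstep w qwall : R := oscillatorV w qwall.

Definition Rc (w1 w2 q1wall q2wall h : R) : set (R * R) :=
  [set e | hstep w1 q1wall < e.1 < h - hstep w2 q2wall /\ e.2 = h - e.1].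

Definition theta_wall w e qwall : R := acos (w * qwall / Num.sqrt (2 * e)).

Definition Theta2 (w1 w2 q1wall e1 : R) : R :=
  2 * (w2 / w1) * acos (w1 * q1wall / Num.sqrt (2 * e1)).

Definition chi2 (w1 w2 q1wall q2wall e1 h : R) : R :=
  w2 / w1 * ((pi - acos (w1 * q1wall / Num.sqrt (2 * e1))) /
             acos (w2 * q2wall / Num.sqrt (2 * (h - e1)))).

(* theta is a value of the angle of (q, p) on {H = e}: the phase 0 is at
   p = 0, p' < 0 (i.e. q maximal) and theta' = w along the oscillation. *)
Definition is_angle w e q p (theta : R) : Prop :=
  q = Num.sqrt (2 * e) / w * cos theta /\ p = - (Num.sqrt (2 * e) * sin theta).

Definition Sigma1 w1 : set (phase R) :=
  [set z | z.2.1 = 0 /\ - derive1 (oscillatorV w1) z.1.1 < 0].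

(* The first-return relation to Sigma1, read in the angle theta2. *)
Definition Sigma1_return (w1 w2 q1wall q2wall e1 e2 theta theta' : R) : Prop :=
  exists z z' : phase R,
    [/\ first_return (step_system w1 w2 q1wall q2wall e1 e2) (Sigma1 w1) z z',
        is_angle w2 e2 z.1.2 z.2.2 theta &
        is_angle w2 e2 z'.1.2 z'.2.2 theta'].

Definition Lshape (A1 A2 a b : R) : set (R * R) :=
  [set x | [/\ 0 <= x.1 <= A1, 0 <= x.2 <= A2 & x.1 <= a \/ x.2 <= b]].

Definition billiard_level (A1 A2 a b v1 v2 : R) : set (phase R) :=
  [set z | [/\ Lshape A1 A2 a b z.1,
               z.2.1 = v1 \/ z.2.1 = - v1 & z.2.2 = v2 \/ z.2.2 = - v2]].

(* [side1] collects the vertical sides, [side2] the horizontal ones. *)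
Definition L_billiard (A1 A2 a b v1 v2 : R) : impact_system R :=
  {| level := billiard_level A1 A2 a b v1 v2;
     force1 := fun=> 0;
     force2 := fun=> 0;
     side1 := [set x | [\/ x.1 = 0, x.1 = A1 | x.1 = a /\ b <= x.2]];
     side2 := [set x | [\/ x.2 = 0, x.2 = A2 | x.2 = b /\ a <= x.1]];
     corner := (a, b) |}.

(* C^n on an open set of the plane, by iterated partial derivatives. *)
Fixpoint Cn_on (n : nat) (U : set (R * R)) (f : R * R -> R) : Prop :=
  match n with
  | 0%N => forall u, U u -> {for u, continuous f}
  | m.+1 =>
    [/\ forall u, U u -> derivable f u (1, 0) /\ derivable f u (0, 1),
        Cn_on m U ('D_((1, 0) : R * R) f) &
        Cn_on m U ('D_((0, 1) : R * R) f)]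
  end.

Definition smooth_on (U : set (R * R)) (f : R * R -> R) : Prop :=
  forall n, Cn_on n U f.

Definition increasing_on (I : set R) (f : R -> R) : Prop :=
  forall x y, I x -> I y -> x < y -> f x < f y.

Definition decreasing_on (I : set R) (f : R -> R) : Prop :=
  forall x y, I x -> I y -> x < y -> f y < f x.

Definition monotone_on (I : set R) (f : R -> R) : Prop :=
  increasing_on I f \/ decreasing_on I f.

Definition opposite_monotonicity_on (I : set R) (f g : R -> R) : Prop :=
  (increasing_on I f /\ decreasing_on I g) \/
  (decreasing_on I f /\ increasing_on I g).

Definition eq2pi x y : Prop := exists k : int, y = x + 2 * pi * k%:~R.

(* The arc [l, l + len) modulo 2 pi. *)
Definition arc (l len : R) : set R :=
  [set x | exists2 y, eq2pi x y & l <= y < l + len].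

(* Consecutive arcs of lengths [lens], the first one starting at [l0]. *)
Definition arc_left (l0 : R) (lens : seq R) (i : nat) : R :=
  l0 + \sum_(len <- take i lens) len.

Definition nth_arc (l0 : R) (lens : seq R) (i : nat) : set R :=
  arc (arc_left l0 lens i) (nth 0 lens i).

(* F represents a bijection of R / 2 pi Z which is a translation on each of
   the consecutive arcs, the latter going exactly once around the circle. *)
Definition interval_exchange (l0 : R) (lens : seq R) (F : R -> R) : Prop :=
  [/\ (forall len, len \in lens -> 0 <= len) /\ \sum_(len <- lens) len = 2 * pi,
      (forall x y, eq2pi x y <-> eq2pi (F x) (F y)),
      (forall y, exists x, eq2pi (F x) y) &
      forall i, (i < size lens)%N ->
        exists c, forall x, nth_arc l0 lens i x -> eq2pi (F x) (x + c)].

Definition fracpart x : R := x - (Num.floor x)%:~R.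

(* Left end point and lengths of J_R, J_{K_2}, J_{K_2 + 1}. *)
Definition J_start (thw Th : R) : R := thw - Th / 2.

Definition J_lengths (thw chi : R) : seq R :=
  [:: 2 * pi - 2 * thw;
      2 * thw * (1 - fracpart chi);
      2 * thw * fracpart chi].

Definition J_arc (thw Th chi : R) (i : nat) : set R :=
  nth_arc (J_start thw Th) (J_lengths thw chi) i.

Definition J_endpoints (thw Th chi : R) : set R :=
  [set x | exists2 i, (i < 3)%N &
     eq2pi x (arc_left (J_start thw Th) (J_lengths thw chi) i)].

(* The last branch is J_{K_2 + 1}, since the three arcs partition the circle. *)
Definition exchange_map (thw Th chi theta : R) : R :=
  let K := Num.floor chi in
  if `[< J_arc thw Th chi 0 theta >] then theta + Th
  else if `[< J_arc thw Th chi 1 theta >] then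
    theta + Th + 2 * thw * fracpart chi + 2 * pi * K%:~R
  else
    theta + Th + 2 * thw * (-1 + fracpart chi) + 2 * pi * (K + 1)%:~R.

End Step.

(* Main.v *)
Require Import Defs.
From mathcomp Require Import all_boot all_order all_algebra.
From mathcomp Require Import all_classical all_reals all_analysis.
From mathcomp Require Import ring lra zify.
From mathcomp Require generic_quotient.
Set Implicit Arguments.
Unset Strict Implicit.
Unset Printing Implicit Defensive.
Import Order.TTheory GRing.Theory Num.Theory.
Import numFieldNormedType.Exports.
Local Open Scope classical_set_scope.
Local Open Scope ring_scope.

(** An oscillator of energy [e] moves on a circle with constant angular speed
    [w]: q = A cos theta and p = - sqrt (2 e) sin theta.  Folding the circle,
    theta |-> |theta| in [[0, pi]], turns the rotation into a free motion of
    speed [w] bouncing at 0 and pi, and the wall q = qwall into the point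
    [theta_wall].  Since q >= qwall means |theta| <= theta_wall, the complement
    of the step becomes the L-shaped table and elastic impacts become elastic
    impacts: this is the conjugacy.

    Both systems are handled through one normal form.  Impacts on a wall happen
    with momentum bounded away from 0, so they cannot accumulate, and a
    coordinate moves elastically iff near each time, on either side, it is
    given by the explicit solution of q'' = - k q started from the state at
    that time, with momentum reversed on the left at an impact
    ([elastic_coordinateP]; k = w^2 for the oscillator, k = 0 for the billiard).
    In this form folding and unfolding are a pointwise trigonometric matter
    ([motion_fold], [motion_unfold]), including at the turning points, which
    are impacts for the billiard only.  On the glued phase spaces the folding
    map is continuous although the folded velocity jumps where p = 0: the two
    velocities found there are identified by the billiard glueing, so the map is
    pasted from continuous maps on finitely many closed pieces.

    The arm widths are acos (w q / sqrt (2 e)).  Their partial derivatives lie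
    in the algebra generated by the constants, q, 1/e and
    1/sqrt (2 e - w^2 q^2), which is stable under differentiation; hence
    smoothness ([theta_wall_smooth]).  Monotonicity follows from that of acos.

    For the return map, the normal form makes trajectories determined by their
    initial state ([step_trajectory_unique]), so it is enough to exhibit one
    trajectory from each point of the section.  Let y be the angle of the
    second oscillator when the first one reaches its wall (angle a), and let b
    be the wall angle of the second oscillator.  If b < y < 2 pi - b, the first
    oscillator bounces back and the second one turns freely throughout.  If
    - b < y < b, the point enters the arm; there the second angle turns on the
    circle [[- b, b]] with ends identified, advances by 2 b chi in total, and
    hence jumps by - 2 b exactly floor ((y + b) / (2 b) + chi) times.  This
    floor is K or K + 1 according to the fractional part of chi, whence the
    two remaining branches.  The exceptional values of y, at which the point
    runs into the corner, are the end points of the three arcs. *)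

(** * One-sided neighbourhoods on the line *)

Section OneSided.
Variable R : realType.
Implicit Types (f g : R -> R) (t s T L : R).

Lemma near_right_ex t (P : set R) : (\forall s \near t^'+, P s) ->
  exists2 d, 0 < d & forall s, t < s < t + d -> P s.
Proof.
move=> /nbhs_right0P [d /= d0 dP]; exists d => // s /andP[ts std].
have := dP (s - t); rewrite /= sub0r normrN gtr0_norm ?subr_gt0// ltrBlDl.
by move=> /(_ std ts); rewrite addrC subrK.
Qed.

Lemma near_left_ex t (P : set R) : (\forall s \near t^'-, P s) ->
  exists2 d, 0 < d & forall s, t - d < s < t -> P s.
Proof.
move=> /nbhs_left0P [d /= d0 dP]; exists d => // s /andP[ts st].
have := dP (t - s); rewrite /= sub0r normrN gtr0_norm ?subr_gt0// ltrBlDr -ltrBlDl.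
by move=> /(_ ts st); rewrite opprB addrC subrK.
Qed.

Lemma near_rightI t d (P : set R) : 0 < d ->
  (forall s, t < s < t + d -> P s) -> \forall s \near t^'+, P s.
Proof.
move=> d0 dP; near=> s; apply: dP; apply/andP; split; near: s.
  exact: nbhs_right_gt.
by apply: nbhs_right_lt; rewrite ltrDl.
Unshelve. all: by end_near. Qed.

Lemma near_leftI t d (P : set R) : 0 < d ->
  (forall s, t - d < s < t -> P s) -> \forall s \near t^'-, P s.
Proof.
move=> d0 dP; near=> s; apply: dP; apply/andP; split; near: s.
  by apply: nbhs_left_gt; rewrite ltrBlDr ltrDl.
exact: nbhs_left_lt.
Unshelve. all: by end_near. Qed.

Lemma near_two_sided t (P : set R) : P t ->
  (\forall s \near t^'-, P s) -> (\forall s \near t^'+, P s) ->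
  \forall s \near t, P s.
Proof.
move=> Pt /near_left_ex[d d0 dP] /near_right_ex[e e0 eP]; near=> s.
have [st|ts|->//] := ltrgtP s t.
  apply: dP; rewrite st andbT; near: s.
  by apply: lt_nbhsr; rewrite ltrBlDr ltrDl.
by apply: eP; rewrite ts /=; near: s; apply: lt_nbhsl; rewrite ltrDl.
Unshelve. all: by end_near. Qed.

Lemma within_segmentP T f : 0 < T ->
  {within `[0, T], continuous f} <->
  (forall t, 0 <= t < T -> f s @[s --> t^'+] --> f t) /\
  (forall t, 0 < t <= T -> f s @[s --> t^'-] --> f t).
Proof.
move=> T0; rewrite continuous_within_itvP//; split=> [[cf f0 fT]|[rf lf]].
  split=> t /andP[].
    rewrite le_eqVlt => /predU1P[<-//|t0] tT.
    by apply: cvg_at_right_filter; apply: cf; rewrite in_itv/= t0.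
  move=> t0; rewrite le_eqVlt => /predU1P[->//|tT].
  by apply: cvg_at_left_filter; apply: cf; rewrite in_itv/= t0.
split; last 2 first.
- by apply: rf; rewrite lexx.
- by apply: lf; rewrite lexx T0.
move=> t; rewrite in_itv/= => /andP[t0 tT].
move=> P /= nP; apply: (near_two_sided (P := fun s => P (f s))).
- exact: nbhs_singleton nP.
- by apply: lf nP; rewrite t0 ltW.
- by apply: rf nP; rewrite tT ltW.
Qed.

Lemma derive0_cst (a b : R) f : (forall t, a < t < b -> is_derive t 1 f 0) ->
  forall s u, a < s < b -> a < u < b -> f s = f u.
Proof.
move=> df.
have main s u : a < s < b -> a < u < b -> s < u -> f s = f u.
  move=> /andP[as_ sb] /andP[au ub] su.
  have su_ab x : s <= x <= u -> a < x < b.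
    by move=> /andP[sx xu]; rewrite (lt_le_trans as_)// (le_lt_trans xu).
  have [|x|c _] := @MVT R f (fun=> 0) s u su.
  - by move=> x /[!in_itv]/= /andP[sx xu]; apply: df; apply: su_ab; rewrite !ltW.
  - apply: derivable_within_continuous => y /[!in_itv]/= syu.
    by apply: ex_derive; apply: df; apply: su_ab.
  by rewrite mul0r => /eqP; rewrite subr_eq0 => /eqP.
move=> s u sab uab; have [su|us|->//] := ltrgtP s u; first exact: main.
by rewrite (main u s).
Qed.

Lemma derive0_right t d f L : 0 < d ->
  (forall s, t < s < t + d -> is_derive s 1 f 0) -> f s @[s --> t^'+] --> L ->
  forall s, t < s < t + d -> f s = L.
Proof.
move=> d0 df fL s std; have /cvg_lim <- // := fL.
apply/esym; apply: lim_near_cst => //.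
by apply: (near_rightI d0) => u utd; apply: (derive0_cst df).
Qed.

Lemma derive0_left t d f L : 0 < d ->
  (forall s, t - d < s < t -> is_derive s 1 f 0) -> f s @[s --> t^'-] --> L ->
  forall s, t - d < s < t -> f s = L.
Proof.
move=> d0 df fL s std; have /cvg_lim <- // := fL.
apply/esym; apply: lim_near_cst => //.
by apply: (near_leftI d0) => u utd; apply: (derive0_cst df).
Qed.

End OneSided.

(** * Elastic motion as locally explicit motion *)

Section Propagator.
Variable R : realType.
Implicit Types (q p : R -> R) (t s T L M : R) (hit : set R).

Variables (k : R) (c sn : R -> R).

(** [c] and [sn] are the solutions of u'' = - k u with the initial data of the
    cosine and of the sine; one theory then covers the oscillator (k = w^2) and
    the free flight (k = 0). *)
Record propagator : Prop := Propagator {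
  prop_c0 : c 0 = 1;
  prop_s0 : sn 0 = 0;
  prop_dc : forall t, is_derive t 1 c (- (k * sn t));
  prop_ds : forall t, is_derive t 1 sn (c t);
  prop_norm : forall t, c t ^+ 2 + k * sn t ^+ 2 = 1 }.

Definition qmove (q0 p0 tau : R) : R := q0 * c tau + p0 * sn tau.
Definition pmove (q0 p0 tau : R) : R := p0 * c tau - k * q0 * sn tau.

(** Momenta are right-continuous, so the one just before [t] has to be recovered
    from the outgoing one. *)
Definition incoming hit p t : R := if `[< hit t >] then - p t else p t.

Definition local_motion T hit q p : Prop :=
  (forall t, 0 <= t < T -> \forall s \near t^'+,
     q s = qmove (q t) (p t) (s - t) /\ p s = pmove (q t) (p t) (s - t)) /\
  (forall t, 0 < t <= T -> \forall s \near t^'-,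
     q s = qmove (q t) (incoming hit p t) (s - t) /\
     p s = pmove (q t) (incoming hit p t) (s - t)).

Hypothesis cs : propagator.

Lemma qmove0 (q0 p0 : R) : qmove q0 p0 0 = q0.
Proof. by rewrite /qmove (prop_c0 cs) (prop_s0 cs) mulr1 mulr0 addr0. Qed.

Lemma pmove0 (q0 p0 : R) : pmove q0 p0 0 = p0.
Proof. by rewrite /pmove (prop_c0 cs) (prop_s0 cs) mulr1 mulr0 subr0. Qed.

Lemma is_derive_shiftB (f : R -> R) (df : R) t0 t :
  is_derive (t - t0) 1 f df -> is_derive t 1 (fun s => f (s - t0)) df.
Proof.
move=> fd; have -> : (fun s => f (s - t0)) = f \o (shift (- t0)) by [].
rewrite -[df]mulr1.
apply: is_derive1_comp => //; apply: is_derive_shift.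
Qed.

Lemma is_derive_qmove (q0 p0 : R) t0 t :
  is_derive t 1 (fun s => qmove q0 p0 (s - t0)) (pmove q0 p0 (t - t0)).
Proof.
apply: (@is_derive_shiftB (qmove q0 p0)).
have dc := prop_dc cs (t - t0); have ds := prop_ds cs (t - t0).
rewrite /qmove; apply: is_derive_eq; rewrite /pmove /= /GRing.scale/=; ring.
Qed.

Lemma is_derive_pmove (q0 p0 : R) t0 t :
  is_derive t 1 (fun s => pmove q0 p0 (s - t0)) (- (k * qmove q0 p0 (t - t0))).
Proof.
apply: (@is_derive_shiftB (pmove q0 p0)).
have dc := prop_dc cs (t - t0); have ds := prop_ds cs (t - t0).
rewrite /pmove; apply: is_derive_eq; rewrite /qmove /= /GRing.scale/=; ring.
Qed.

Lemma is_derive_cvg (f : R -> R) t (d : R) :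
  is_derive t 1 f d -> f s @[s --> t] --> f t.
Proof.
by move=> df; apply/differentiable_continuous/derivable1_diffP; exact: ex_derive.
Qed.

Lemma cvg_qmove (q0 p0 : R) t0 t :
  qmove q0 p0 (s - t0) @[s --> t] --> qmove q0 p0 (t - t0).
Proof. exact: is_derive_cvg (is_derive_qmove q0 p0 t0 t). Qed.

Lemma cvg_pmove (q0 p0 : R) t0 t :
  pmove q0 p0 (s - t0) @[s --> t] --> pmove q0 p0 (t - t0).
Proof. exact: is_derive_cvg (is_derive_pmove q0 p0 t0 t). Qed.

(** Rotating a solution back in time freezes it: these are its two constants of
    motion, i.e. its state at time [t0]. *)
Lemma is_derive_back q p t0 t :
  is_derive t 1 q (p t) -> is_derive t 1 p (- (k * q t)) ->
  is_derive t 1 (fun s => q s * c (s - t0) - p s * sn (s - t0)) 0 /\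
  is_derive t 1 (fun s => p s * c (s - t0) + k * q s * sn (s - t0)) 0.
Proof.
move=> dq dp.
have dc := is_derive_shiftB (prop_dc cs (t - t0)).
have ds := is_derive_shiftB (prop_ds cs (t - t0)).
by split; apply: is_derive_eq; rewrite /= /GRing.scale/=; ring.
Qed.

Lemma back_solve (x y cc ss : R) (u v : R) : cc ^+ 2 + k * ss ^+ 2 = 1 ->
  x * cc - y * ss = u -> y * cc + k * x * ss = v ->
  x = u * cc + v * ss /\ y = v * cc - k * u * ss.
Proof.
move=> n <- <-; split.
  by rewrite -[LHS]mulr1 -n; ring.
by rewrite -[LHS]mulr1 -n; ring.
Qed.

Lemma cvg_back (F : set_system R) {FF : ProperFilter F} q p t0 L M :
  F `=>` nbhs t0 -> q @ F --> L -> p @ F --> M ->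
  (fun s : R => q s * c (s - t0) - p s * sn (s - t0)) @ F --> L /\
  (fun s : R => p s * c (s - t0) + k * q s * sn (s - t0)) @ F --> M.
Proof.
move=> Ft qL pM.
have cc : (fun s : R => c (s - t0)) @ F --> (1 : R).
  have := is_derive_cvg (is_derive_shiftB (prop_dc cs (t0 - t0))).
  by rewrite subrr (prop_c0 cs); apply: cvg_trans; exact: cvg_app.
have ss : (fun s : R => sn (s - t0)) @ F --> (0 : R).
  have := is_derive_cvg (is_derive_shiftB (prop_ds cs (t0 - t0))).
  by rewrite subrr (prop_s0 cs); apply: cvg_trans; exact: cvg_app.
split.
  rewrite (_ : L = L * 1 - M * 0); last by ring.
  by apply: cvgB; apply: cvgM.
rewrite (_ : M = M * 1 + k * L * 0); last by ring.
by apply: cvgD; apply: cvgM => //; apply: cvgM => //; exact: cvg_cst.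
Qed.

(** Between impacts the constants of motion equal their limits at [t], and undoing
    the backward rotation gives the explicit solution. *)
Lemma motion_right q p t d L M : 0 < d ->
  (forall s, t < s < t + d -> is_derive s 1 q (p s) /\
                              is_derive s 1 p (- (k * q s))) ->
  q s @[s --> t^'+] --> L -> p s @[s --> t^'+] --> M ->
  forall s, t < s < t + d ->
    q s = qmove L M (s - t) /\ p s = pmove L M (s - t).
Proof.
move=> d0 dqp qL pM s std.
have at_nbhs : t^'+ `=>` nbhs t by exact: cvg_within.
have [UL WM] := cvg_back at_nbhs qL pM.
apply: back_solve; first exact: (prop_norm cs).
- apply: (derive0_right d0 _ UL) std => u /dqp[dq dp].
  exact: (is_derive_back t dq dp).1.
- apply: (derive0_right d0 _ WM) std => u /dqp[dq dp].
  exact: (is_derive_back t dq dp).2.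
Qed.

Lemma motion_left q p t d L M : 0 < d ->
  (forall s, t - d < s < t -> is_derive s 1 q (p s) /\
                              is_derive s 1 p (- (k * q s))) ->
  q s @[s --> t^'-] --> L -> p s @[s --> t^'-] --> M ->
  forall s, t - d < s < t ->
    q s = qmove L M (s - t) /\ p s = pmove L M (s - t).
Proof.
move=> d0 dqp qL pM s std.
have at_nbhs : t^'- `=>` nbhs t by exact: cvg_within.
have [UL WM] := cvg_back at_nbhs qL pM.
apply: back_solve; first exact: (prop_norm cs).
- apply: (derive0_left d0 _ UL) std => u /dqp[dq dp].
  exact: (is_derive_back t dq dp).1.
- apply: (derive0_left d0 _ WM) std => u /dqp[dq dp].
  exact: (is_derive_back t dq dp).2.
Qed.

(** Impacts cannot accumulate where [p] stays close to some [L]: both [p s] and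
    its reverse, the left limit at an impact [s], would be close to [L], forcing
    a small |p s|. *)
Lemma no_hit_near hit p (a b L m : R) : 0 < m ->
  (forall s, a < s < b -> `|p s - L| < m / 2) ->
  (forall s, a < s < b -> hit s -> p u @[u --> s^'-] --> - p s /\ m <= `|p s|) ->
  forall s, a < s < b -> ~ hit s.
Proof.
move=> m0 pL ph s sab /(ph _ sab)[ps mp].
have : `|- p s - L| <= m / 2.
  have cv : `|p u - L| @[u --> s^'-] --> `|- p s - L|.
    by apply: cvg_norm; apply: cvgB => //; exact: cvg_cst.
  have /cvg_lim <- // := cv.
  apply: limr_le; first exact: cvgP cv.
  case/andP: sab => as_ sb.
  near=> u; apply: ltW; apply: pL; apply/andP; split; near: u.
    exact: nbhs_left_gt.
  by apply: filterS (nbhs_left_lt s) => u us; exact: lt_trans us sb.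
have := pL _ sab; move: mp; rewrite !ltr_norml !ler_norml.
case: (lerP 0 (p s)) => ps0; [rewrite ger0_norm//|rewrite ltr0_norm//]; lra.
Unshelve. all: by end_near. Qed.

Lemma no_hit_right T hit p m t : 0 < m ->
  (forall t, 0 <= t <= T -> hit t -> m <= `|p t|) ->
  (forall t, 0 < t <= T -> hit t -> p s @[s --> t^'-] --> - p t) ->
  p s @[s --> t^'+] --> p t -> 0 <= t < T ->
  exists2 d, 0 < d & forall s, t < s < t + d -> 0 < s < T /\ ~ hit s.
Proof.
move=> m0 hm hl pr /andP[t0 tT].
have : \forall s \near t^'+, `|p s - p t| < m / 2.
  by move/cvgrPdist_lt : pr => /(_ (m / 2)) H; near=> s; rewrite distrC; near: s;
    apply: H; rewrite divr_gt0.
move=> /near_right_ex[d d0 dP]; exists (Num.min d (T - t)).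
  by rewrite lt_min d0 subr_gt0.
have sub s : t < s < t + Num.min d (T - t) -> t < s < t + d /\ 0 < s < T.
  move=> /andP[ts]; rewrite -ltrBlDl lt_min => /andP[sd sT].
  by rewrite ts -ltrBlDl sd (le_lt_trans t0 ts) -(ltrD2r (- t)) sT.
move=> s std; split; first exact: (sub _ std).2.
apply: (@no_hit_near hit p _ _ (p t) m) std => // u /sub[utd /andP[u0 uT]].
  exact: dP.
by move=> hu; split; [apply: hl => //; rewrite u0 ltW|apply: hm => //; rewrite !ltW].
Unshelve. all: by end_near. Qed.

Lemma no_hit_left T hit p m t L : 0 < m ->
  (forall t, 0 <= t <= T -> hit t -> m <= `|p t|) ->
  (forall t, 0 < t <= T -> hit t -> p s @[s --> t^'-] --> - p t) ->
  p s @[s --> t^'-] --> L -> 0 < t <= T ->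
  exists2 d, 0 < d & forall s, t - d < s < t -> 0 < s < T /\ ~ hit s.
Proof.
move=> m0 hm hl pr /andP[t0 tT].
have : \forall s \near t^'-, `|p s - L| < m / 2.
  by move/cvgrPdist_lt : pr => /(_ (m / 2)) H; near=> s; rewrite distrC; near: s;
    apply: H; rewrite divr_gt0.
move=> /near_left_ex[d d0 dP]; exists (Num.min d t).
  by rewrite lt_min d0.
have sub s : t - Num.min d t < s < t -> t - d < s < t /\ 0 < s < T.
  move=> /andP[+ ts]; rewrite ltrBlDr -ltrBlDl lt_min => /andP[sd sT].
  by rewrite ts ltrBlDr -ltrBlDl sd (lt_le_trans ts tT) andbT; split=> //; lra.
move=> s std; split; first exact: (sub _ std).2.
apply: (@no_hit_near hit p _ _ L m) std => // u /sub[utd /andP[u0 uT]].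
  exact: dP.
by move=> hu; split; [apply: hl => //; rewrite u0 ltW|apply: hm => //; rewrite !ltW].
Unshelve. all: by end_near. Qed.

Lemma incomingE hit p t : incoming hit p t = p t \/ incoming hit p t = - p t.
Proof. by rewrite /incoming; case: asboolP => _; [right|left]. Qed.

(** The lower bound [m] on the speed of impacts excludes their accumulation, so
    that each time is the end point of intervals free of impacts, on which the
    motion is explicit. *)
Lemma elastic_coordinateP T f hit q p m : 0 < m -> (forall x, f x = - (k * x)) ->
  (forall t, 0 <= t <= T -> hit t -> m <= `|p t|) ->
  elastic_coordinate T f hit q p <-> local_motion T hit q p.
Proof.
move=> m0 fE hm; split=> [[cq dqp pr pl ph]|[mr ml]].
  split=> t tT.
    have [/le_lt_trans T0] : 0 <= t /\ t < T by case/andP: tT.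
    move=> /T0 {}T0.
    have [qr _] := (within_segmentP q T0).1 cq.
    have [d d0 dP] := no_hit_right m0 hm ph (pr _ tT) tT.
    apply: (near_rightI d0); apply: (motion_right d0 _ (qr _ tT) (pr _ tT)).
    by move=> s /dP[sT hs]; rewrite -fE; exact: dqp.
  have [/lt_le_trans T0] : 0 < t /\ t <= T by case/andP: tT.
  move=> /T0 {}T0.
  have [_ ql] := (within_segmentP q T0).1 cq.
  have pinc : p s @[s --> t^'-] --> incoming hit p t.
    by rewrite /incoming; case: asboolP => ht; [exact: ph|exact: pl].
  have [d d0 dP] := no_hit_left m0 hm ph pinc tT.
  apply: (near_leftI d0); apply: (motion_left d0 _ (ql _ tT) pinc).
  by move=> s /dP[sT hs]; rewrite -fE; exact: dqp.
have qmc (q0 p0 : R) t : qmove q0 p0 (s - t) @[s --> t] --> q0.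
  by have := @cvg_qmove q0 p0 t t; rewrite subrr qmove0.
have pmc (q0 p0 : R) t : pmove q0 p0 (s - t) @[s --> t] --> p0.
  by have := @cvg_pmove q0 p0 t t; rewrite subrr pmove0.
have pl t : 0 < t <= T -> p s @[s --> t^'-] --> incoming hit p t.
  move=> /ml mt; apply: cvg_trans (cvg_at_left_filter (pmc (q t) _ t)).
  by apply: near_eq_cvg; apply: filterS mt => s [].
split.
- have [T0|T0|<-] := ltrgtP 0 T; last 2 first.
  + by rewrite set_itv_ge ?bnd_simp -?ltNge//; exact: continuous_subspace0.
  + by rewrite set_itv1; exact: continuous_subspace1.
  apply/(within_segmentP _ T0); split=> t tT.
    apply: cvg_trans (cvg_at_right_filter (qmc (q t) (p t) t)).
    by apply: near_eq_cvg; apply: filterS (mr _ tT) => s [].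
  apply: cvg_trans (cvg_at_left_filter (qmc (q t) (incoming hit p t) t)).
  by apply: near_eq_cvg; apply: filterS (ml _ tT) => s [].
- move=> t /andP[t0 tT] ht.
  have nt : \forall s \near t, qmove (q t) (p t) (s - t) = q s /\
                                pmove (q t) (p t) (s - t) = p s.
    apply: near_two_sided; first by rewrite subrr qmove0 pmove0.
      have := ml t; rewrite t0 ltW// => /(_ erefl); rewrite /incoming.
      by case: asboolP => // _; apply: filterS => s [-> ->].
    by have := mr t; rewrite tT ltW// => /(_ erefl); apply: filterS => s [-> ->].
  split.
    apply: near_eq_is_derive; first by apply: filterS nt => s [E _]; exact: E.
    by have := is_derive_qmove (q t) (p t) t t; rewrite subrr pmove0.
  apply: near_eq_is_derive; first by apply: filterS nt => s [_ E]; exact: E.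
  by have := is_derive_pmove (q t) (p t) t t; rewrite subrr qmove0 fE.
- move=> t tT; apply: cvg_trans (cvg_at_right_filter (pmc (q t) (p t) t)).
  by apply: near_eq_cvg; apply: filterS (mr _ tT) => s [].
- by move=> t /pl + ht; rewrite /incoming; case: asboolP.
- by move=> t /pl + ht; rewrite /incoming; case: asboolP.
Qed.

End Propagator.

(** * Folding an oscillator into a billiard coordinate *)

Section Coordinate.
Variable R : realType.
Implicit Types (t s T x v q p : R).

Lemma is_derive_scale (w t : R) : is_derive t 1 ( *%R w) w.
Proof.
have -> : *%R w = w \*: (@id R) by [].
by apply: is_derive_eq; rewrite /GRing.scale/= mulr1.
Qed.

Lemma harmonic_propagator (w : R) : w != 0 ->
  propagator (w ^+ 2) (fun t => cos (w * t)) (fun t => sin (w * t) / w).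
Proof.
move=> w0; split.
- by rewrite mulr0 cos0.
- by rewrite mulr0 sin0 mul0r.
- move=> t; have dw := is_derive_scale w t.
  have := is_derive1_comp (is_derive_cos (w * t)) dw.
  by move=> /is_derive_eq; apply; field.
- move=> t; have dw := is_derive_scale w t.
  have dv := is_derive_scale w^-1 (sin (w * t)).
  have := is_derive1_comp dv (is_derive1_comp (is_derive_sin (w * t)) dw).
  have -> : *%R w^-1 \o (sin \o *%R w) = (fun t => sin (w * t) / w).
    by apply/funext => u /=; rewrite mulrC.
  by move=> /is_derive_eq; apply; field.
- move=> t; rewrite expr_div_n mulrCA divff ?sqrf_eq0// mulr1.
  exact: cos2Dsin2.
Qed.

Lemma free_propagator : propagator (0 : R) (fun=> 1) id.
Proof.
split=> [//|//|t|t|t].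
- by rewrite mul0r oppr0; exact: is_derive_cst.
- exact: is_derive_id.
- by rewrite expr1n mul0r addr0.
Qed.

Definition harmonic_motion (w T : R) (hit : set R) (q p : R -> R) : Prop :=
  local_motion (w ^+ 2) (fun t => cos (w * t)) (fun t => sin (w * t) / w) T hit q p.
Definition free_motion (T : R) (hit : set R) (q p : R -> R) : Prop :=
  local_motion (0 : R) (fun=> 1) id T hit q p.

Variables (w e : R).
Hypotheses (w_gt0 : 0 < w) (e_gt0 : 0 < e).

Let E := Num.sqrt (2 * e).
Let A := E / w.

Let E_gt0 : 0 < E. Proof. by rewrite sqrtr_gt0 mulr_gt0. Qed.
Let E_neq0 : E != 0. Proof. exact: lt0r_neq0. Qed.
Let w_neq0 : w != 0. Proof. exact: lt0r_neq0. Qed.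
Let E2 : E ^+ 2 = 2 * e. Proof. by rewrite sqr_sqrtr// mulr_ge0// ltW. Qed.

Definition fold_angle q : R := acos (w * q / E).
(** At a turning point (p = 0) both signs describe the same state; the outgoing
    one is chosen, so that the folded velocity is right-continuous. *)
Definition fold_velocity q p : R :=
  if (p < 0) || ((p == 0) && (0 < q)) then w else - w.
Definition unfold_q x : R := A * cos x.
Definition unfold_p x v : R := - (E * sin x * (v / w)).

(** The billiard states from which the free motion stays on the table for small
    positive times; folding takes only such values. *)
Definition outgoing x v : Prop :=
  [\/ 0 < x < pi, x = 0 /\ v = w | x = pi /\ v = - w].

Lemma fold_unfold x v : v = w \/ v = - w -> outgoing x v ->
  fold_angle (unfold_q x) = x /\ fold_velocity (unfold_q x) (unfold_p x v) = v.
Proof.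
have Ecos : w * unfold_q x / E = cos x.
  by rewrite /unfold_q /A; field; rewrite w_neq0 E_neq0.
move=> vw [xpi|[x0 ve]|[x0 ve]].
- rewrite /fold_angle Ecos cosK; last first.
    by rewrite in_itv/=; case/andP: xpi => *; rewrite !ltW.
  split=> //; have sx := sin_gt0_pi xpi; rewrite /fold_velocity /unfold_p.
  have Es : 0 < E * sin x by rewrite mulr_gt0.
  case: vw => ->.
    by rewrite divff// mulr1 oppr_lt0 Es.
  by rewrite mulNr divff// mulrN1 opprK lt_gtF// gt_eqF.
- rewrite /fold_angle Ecos x0 cosK ?in_itv/= ?lexx ?pi_ge0//; split=> //.
  rewrite /fold_velocity /unfold_p /unfold_q sin0 cos0 mulr0 mul0r oppr0 eqxx ltxx.
  by rewrite mulr1 divr_gt0.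
- rewrite /fold_angle Ecos x0 cosK ?in_itv/= ?lexx ?pi_ge0//; split=> //.
  rewrite /fold_velocity /unfold_p /unfold_q sinpi cospi mulr0 mul0r oppr0 eqxx ltxx.
  by rewrite mulrN1 oppr_gt0 lt_gtF ?divr_gt0.
Qed.

Lemma fold_angle_arg q p : oscillatorH w q p = e ->
  -1 <= w * q / E <= 1 /\ sin (fold_angle q) = `|p| / E.
Proof.
rewrite /oscillatorH /oscillatorV => He.
have h1 : (w * q / E) ^+ 2 + (p / E) ^+ 2 = 1.
  rewrite !expr_div_n E2 -mulrDl; apply/eqP; rewrite -(inj_eq (mulIf (lt0r_neq0 e_gt0))).
  rewrite mul1r; apply/eqP; rewrite -[RHS]He; field; exact: lt0r_neq0.
have h2 : -1 <= w * q / E <= 1.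
  by rewrite -ler_norml -(@ler_pXn2r _ 2) ?nnegrE// expr1n -normrX ger0_norm ?sqr_ge0//
    -h1 lerDl sqr_ge0.
split => //; rewrite /fold_angle sin_acos//.
rewrite (_ : 1 - _ = (p / E) ^+ 2); last by rewrite -h1 addrC addKr.
by rewrite sqrtr_sqr normf_div (gtr0_norm E_gt0).
Qed.

Lemma fold_velocityE q p : fold_velocity q p = w \/ fold_velocity q p = - w.
Proof. by rewrite /fold_velocity; case: ifP => _; [left|right]. Qed.

Lemma fold_angle_itv q p : oscillatorH w q p = e -> 0 <= fold_angle q <= pi.
Proof.
by move=> /fold_angle_arg[a _]; rewrite /fold_angle acos_ge0// acos_lepi.
Qed.

Lemma unfold_q_fold q p : oscillatorH w q p = e -> unfold_q (fold_angle q) = q.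
Proof.
move=> He; rewrite /unfold_q acosK; last first.
  by rewrite in_itv/=; exact: (fold_angle_arg He).1.
by rewrite /A; field; rewrite w_neq0 E_neq0.
Qed.

Lemma unfold_p_fold q p : oscillatorH w q p = e ->
  unfold_p (fold_angle q) (fold_velocity q p) = p.
Proof.
move=> He; rewrite /unfold_p (fold_angle_arg He).2 /fold_velocity.
have [p0|p0|->] := ltrgtP p 0 => /=.
- by rewrite ltr0_norm// ?divff// ?mulr1; field.
- by rewrite gtr0_norm//; field; rewrite w_neq0 E_neq0.
- by rewrite normr0 mul0r mulr0 mul0r oppr0.
Qed.

Lemma outgoing_fold q p : oscillatorH w q p = e ->
  outgoing (fold_angle q) (fold_velocity q p).
Proof.
move=> He; have /andP[x0 xpi] := fold_angle_itv He.
have [p0|p0] := eqVneq p 0; last first.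
  apply: Or31; have sx : sin (fold_angle q) != 0.
    by rewrite (fold_angle_arg He).2 mulf_neq0 ?normr_eq0// invr_neq0.
  rewrite !lt_neqAle x0 xpi !andbT; apply/andP; split; apply: contraNneq sx.
    by move=> <-; rewrite sin0.
  by move=> ->; rewrite sinpi.
have := (fold_angle_arg He).2; rewrite p0 normr0 mul0r => sx.
have xe : fold_angle q = 0 \/ fold_angle q = pi.
  have [|n0] := eqVneq (fold_angle q) 0; first by left.
  have [|npi] := eqVneq (fold_angle q) pi; first by right.
  have /gt_eqF : 0 < sin (fold_angle q).
    by apply: sin_gt0_pi; rewrite !lt_neqAle x0 xpi eq_sym n0 npi.
  by rewrite sx eqxx.
have uq := unfold_q_fold He.
case: xe uq => xE; rewrite xE /unfold_q /fold_velocity ltxx eqxx/=.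
  by rewrite cos0 mulr1 => <-; rewrite divr_gt0//; apply: Or32.
by rewrite cospi mulrN1 => <-; rewrite oppr_gt0 lt_gtF ?divr_gt0//; apply: Or33.
Qed.

Lemma unfold_H x v : v = w \/ v = - w ->
  oscillatorH w (unfold_q x) (unfold_p x v) = e.
Proof.
move=> vw; rewrite /oscillatorH /oscillatorV /unfold_q /unfold_p.
have v2 : (v / w) ^+ 2 = 1.
  by case: vw => ->; rewrite ?mulNr ?sqrrN divff// expr1n.
rewrite sqrrN exprMn v2 mulr1 !exprMn exprVn E2.
rewrite (_ : w ^+ 2 * _ = 2 * e * cos x ^+ 2); last by field.
by rewrite -[RHS]mulr1 -[X in _ = e * X](cos2Dsin2 x); field.
Qed.

Let qmoveH := qmove (fun t => cos (w * t)) (fun t => sin (w * t) / w).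
Let pmoveH := pmove (w ^+ 2) (fun t => cos (w * t)) (fun t => sin (w * t) / w).

(** The unfolded point rotates with the phase x at speed [v], hence with the
    phase of the circle at speed [w]: the sign of [v] is the half circle. *)
Lemma unfold_move x v tau : v = w \/ v = - w ->
  unfold_q (x + v * tau) = qmoveH (unfold_q x) (unfold_p x v) tau /\
  unfold_p (x + v * tau) v = pmoveH (unfold_q x) (unfold_p x v) tau.
Proof.
move=> vw; rewrite /qmoveH /pmoveH /qmove /pmove /unfold_q /unfold_p cosD sinD /A.
by case: vw => ->; rewrite ?mulNr ?cosN ?sinN; split; field.
Qed.

Lemma unfold_pN x v : unfold_p x (- v) = - unfold_p x v.
Proof. by rewrite /unfold_p mulNr mulrN opprK. Qed.

Lemma unfold_p_turn x v : x = 0 \/ x = pi -> unfold_p x v = 0.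
Proof. by case=> ->; rewrite /unfold_p ?sin0 ?sinpi mulr0 mul0r oppr0. Qed.

(** A bounce at 0 or pi is no impact for the oscillator: there the momentum
    vanishes, so both billiard velocities unfold to the same state. *)
Lemma motion_unfold T (hit : set R) (x v : R -> R) :
  (forall t, 0 <= t <= T -> v t = w \/ v t = - w) ->
  free_motion T [set t | hit t \/ x t = 0 \/ x t = pi] x v ->
  harmonic_motion w T hit (fun t => unfold_q (x t)) (fun t => unfold_p (x t) (v t)).
Proof.
move=> vw [mr ml]; split=> t tT.
  have {}vw : v t = w \/ v t = - w.
    by apply: vw; case/andP: tT => -> /ltW ->.
  apply: filterS (mr t tT) => s; rewrite /qmove /pmove !mul0r mulr1 subr0 => -[-> ->].
  by rewrite mulr1; exact: unfold_move.
have {}vw : v t = w \/ v t = - w.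
  by apply: vw; case/andP: tT => /ltW -> ->.
have {}vwN : - v t = w \/ - v t = - w.
  by case: vw => ->; rewrite ?opprK; [right|left].
apply: filterS (ml t tT) => s; rewrite /qmove /pmove !mul0r mulr1 subr0 => -[-> ->].
rewrite mulr1 /incoming.
case: asboolP => [hb|]; case: asboolP => [h|nh].
- by rewrite -unfold_pN; exact: unfold_move.
- case: hb => [//|turn].
  rewrite (_ : unfold_p (x t) (v t) = unfold_p (x t) (- v t)); last first.
    by rewrite !unfold_p_turn.
  exact: unfold_move.
- by move=> /not_orP[].
- by move=> _; exact: unfold_move.
Qed.

Lemma outgoing_right x v : v = w \/ v = - w -> outgoing x v ->
  \forall tau \near 0^'+, 0 < x + v * tau < pi.
Proof.
have hpi := pi_gt0 R.
move=> vw; set m := Num.min (if x == 0 then pi else x) (if x == pi then pi else pi - x).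
move=> ox; have m0 : 0 < m.
  rewrite /m lt_min; case: ox => [/andP[x0 xpi]|[-> _]|[-> _]].
  - by rewrite gt_eqF// x0 lt_eqF// subr_gt0.
  - by rewrite eqxx hpi lt_eqF// subr0.
  - by rewrite eqxx gt_eqF// hpi.
apply: (near_rightI (d := m / w)); first by rewrite divr_gt0.
move=> tau; rewrite add0r => /andP[t0]; rewrite ltr_pdivlMr// /m lt_min => /andP[].
have wt : 0 < w * tau by rewrite mulr_gt0.
case: ox => [/andP[x0 xpi]|[-> ->]|[-> ->]].
- rewrite gt_eqF// lt_eqF// [tau * w]mulrC; case: vw => ->; lra.
- rewrite eqxx lt_eqF// [tau * w]mulrC; lra.
- rewrite eqxx gt_eqF// [tau * w]mulrC; lra.
Qed.

(** The explicit motion of the oscillator is the unfolding of a free motion, and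
    folding recovers the latter as long as it stays inside ]0, pi[.  This holds
    after [t] because the folded state is outgoing, and before [t] because the
    incoming state with its velocity reversed is outgoing too. *)
Lemma motion_fold T (hit : set R) (q p : R -> R) :
  (forall t, 0 <= t <= T -> oscillatorH w (q t) (p t) = e) ->
  harmonic_motion w T hit q p ->
  free_motion T [set t | hit t \/ fold_angle (q t) = 0 \/ fold_angle (q t) = pi]
    (fun t => fold_angle (q t)) (fun t => fold_velocity (q t) (p t)).
Proof.
have cs := harmonic_propagator w_neq0.
move=> He [mr ml].
have main t (x v : R) (s : R) : v = w \/ v = - w -> 0 < x + v * (s - t) < pi ->
    q s = qmoveH (unfold_q x) (unfold_p x v) (s - t) ->
    p s = pmoveH (unfold_q x) (unfold_p x v) (s - t) ->
    fold_angle (q s) = x + v * (s - t) /\ fold_velocity (q s) (p s) = v.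
  move=> vw xs -> ->; have [<- <-] := unfold_move x (s - t) vw.
  by apply: fold_unfold => //; apply: Or31.
split=> t tT.
  have /He Ht : 0 <= t <= T by case/andP: tT => -> /ltW ->.
  have vw := fold_velocityE (q t) (p t).
  have [d d0 dP] := near_right_ex (outgoing_right vw (outgoing_fold Ht)).
  have [d' d'0 d'P] := near_right_ex (mr t tT).
  apply: (near_rightI (d := Num.min d d')); first by rewrite lt_min d0.
  move=> s /andP[ts]; rewrite -ltrBlDl lt_min => /andP[sd sd'].
  have {dP} sx := dP (s - t); rewrite subr_gt0 ts add0r sd in sx.
  have {d'P} := d'P s; rewrite ts -ltrBlDl sd' => /(_ erefl)[qs ps].
  have [||-> ->] := main t (fold_angle (q t)) (fold_velocity (q t) (p t)) s vw (sx erefl).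
  - by rewrite (unfold_q_fold Ht) (unfold_p_fold Ht).
  - by rewrite (unfold_q_fold Ht) (unfold_p_fold Ht).
  by rewrite /qmove /pmove mulr1 !mul0r subr0 mulr1.
have /He Ht : 0 <= t <= T by case/andP: tT => /ltW -> ->.
set x := fold_angle (q t); set v := fold_velocity (q t) (p t).
set v' := incoming _ _ t.
have vw : v = w \/ v = - w by exact: fold_velocityE.
have vw' : v' = w \/ v' = - w.
  rewrite /v'; case: (incomingE [set t | hit t \/ fold_angle (q t) = 0 \/ fold_angle (q t) = pi]
    (fun t => fold_velocity (q t) (p t)) t) => -> //; rewrite -/v.
  by case: vw => ->; rewrite ?opprK; [right|left].
have vwN' : - v' = w \/ - v' = - w.
  by case: vw' => ->; rewrite ?opprK; [right|left].
have og : outgoing x v := outgoing_fold Ht.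
(* just before [t] the folded point comes backwards from the inside *)
have og' : outgoing x (- v').
  rewrite /v' /incoming; case: asboolP => [_|/not_orP[_ /not_orP[x0 xpi]]].
    by rewrite opprK.
  by apply: Or31; case: og => [//|[/x0]|[/xpi]].
have [d d0 dP] := near_right_ex (outgoing_right vwN' og').
have [d' d'0 d'P] := near_left_ex (ml t tT).
apply: (near_leftI (d := Num.min d d')); first by rewrite lt_min d0.
move=> s /andP[+ st]; rewrite ltrBlDr -ltrBlDl lt_min => /andP[sd sd'].
have {dP} := dP (t - s); rewrite subr_gt0 st add0r sd mulNr -mulrN opprB.
move=> /(_ erefl) sx.
have {d'P} := d'P s; rewrite st ltrBlDr -ltrBlDl sd' => /(_ erefl)[qs ps].
have pE : incoming hit p t = unfold_p x v'.
  rewrite /incoming /v' /incoming.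
  case: asboolP => [h|nh]; case: asboolP => [hb|] //.
  - by rewrite unfold_pN (unfold_p_fold Ht).
  - by move=> /not_orP[].
  - case: hb => // turn; rewrite unfold_pN (unfold_p_fold Ht).
    by have := unfold_p_fold Ht; rewrite (unfold_p_turn _ turn) => <-; rewrite oppr0.
  - by rewrite (unfold_p_fold Ht).
have [||-> ->] := main t x v' s vw' sx.
- by rewrite (unfold_q_fold Ht) -pE.
- by rewrite (unfold_q_fold Ht) -pE.
by rewrite /qmove /pmove mulr1 !mul0r subr0 mulr1.
Qed.

End Coordinate.

(** * Quotient topologies and conjugacy *)

Section Topology.
Variable R : realType.

Lemma acos_le_mono : {in `[-1, 1] &, {mono (@acos R) : x y /~ x <= y}}.
Proof.
move=> x y xI yI /=.
have xJ : acos x \in `[0, pi].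
  by move: xI; rewrite !in_itv/= => xI; rewrite acos_ge0// acos_lepi.
have yJ : acos y \in `[0, pi].
  by move: yI; rewrite !in_itv/= => yI; rewrite acos_ge0// acos_lepi.
by rewrite leNgt -(ltr_cos yJ xJ) !acosK// -leNgt.
Qed.

Lemma acos_within : {within `[-1, 1]%classic, continuous (@acos R)}.
Proof.
apply: segment_dec_surj_continuous; first exact: acos_le_mono.
rewrite acos1 acosN1 => x /= xI; exists (cos x); last by rewrite cosK.
by rewrite in_itv/= cos_geN1 cos_le1.
Qed.

(** At the turning points the argument of acos reaches 1 or -1, where acos is
    continuous only from inside the segment. *)
Lemma continuous_acos_comp (T : topologicalType) (u : T -> R) :
  continuous u -> (forall x, -1 <= u x <= 1) -> continuous (fun x => acos (u x)).
Proof.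
move=> cu u1.
have u1' x : u x \in `[-1, 1]%classic by rewrite inE/= in_itv/= u1.
pose v (x : T) : `[(-1 : R), 1]%classic := exist _ (u x) (u1' x).
have cv : continuous v by apply: continuous_comp_initial; exact: cu.
have ca := (@subspace_sigL_continuousP _ _ _ _).1 acos_within.
rewrite (_ : (fun x => _) = sigL `[(-1 : R), 1]%classic (@acos R) \o v); last by [].
by move=> x; apply: continuous_comp; [exact: cv | exact: ca].
Qed.

(** Pasting on a finite closed cover: near [x] only the pieces containing [x] are
    met, since the complement of each of the others is a neighbourhood. *)
Lemma closed_cover_continuous (I : finType) (X Y : topologicalType)
    (D : I -> set X) (h : X -> Y) (H : I -> X -> Y) :
  (forall i, closed (D i)) -> (forall x, exists i, D i x) ->
  (forall i, continuous (H i)) -> (forall i x, D i x -> h x = H i x) ->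
  continuous h.
Proof.
move=> cD cov cH hH x U; rewrite nbhs_simpl/= => Ux.
have : \forall y \near x, forall i, D i y -> U (H i y).
  apply: filter_forall => i.
  have [Dx|nDx] := pselect (D i x).
    rewrite (hH i x Dx) in Ux.
    by have := cH i x U Ux; rewrite nbhs_simpl/=; apply: filterS.
  have : open (~` D i) by rewrite openC.
  rewrite openE => /(_ _ nDx); apply: filterS => y nDy Dy.
  by have := nDy Dy.
apply: filterS => y Hy /=; have [i Di] := cov y.
by rewrite (hH i y Di); exact: Hy.
Qed.

Variables S1 S2 : impact_system R.

Lemma glued_classP (S : impact_system R) (z w : set_type (level S)) :
  glued_class z = glued_class w <-> glued S (set_val z) (set_val w).
Proof.
split => [|zw].
  by rewrite /glued_class => /generic_quotient.eqmodP/asboolP.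
by apply/generic_quotient.eqmodP/asboolP.
Qed.

Lemma glued_class_surj (S : impact_system R) (x : glued_level S) :
  exists z, glued_class z = x.
Proof. by exists (generic_quotient.repr x); rewrite /glued_class generic_quotient.reprK. Qed.

Lemma glued_class_continuous (S : impact_system R) : continuous (@glued_class R S).
Proof. exact: pi_continuous. Qed.

(** The maps [F] and [G] need not be continuous nor inverse of each other on the
    phase spaces: everything is asked up to glueing, including the continuity of
    the induced maps. *)
Lemma conjugated_by_phase_map (F G : phase R -> phase R) :
  (forall z, level S1 z -> level S2 (F z)) ->
  (forall z, level S2 z -> level S1 (G z)) ->
  (forall z w, level S1 z -> level S1 w -> glued S1 z w -> glued S2 (F z) (F w)) ->
  (forall z w, level S2 z -> level S2 w -> glued S2 z w -> glued S1 (G z) (G w)) ->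
  (forall z, level S1 z -> glued S1 (G (F z)) z) ->
  (forall z, level S2 z -> glued S2 (F (G z)) z) ->
  (forall T z, trajectory S1 T z -> trajectory S2 T (F \o z)) ->
  (forall T z, trajectory S2 T z -> trajectory S1 T (G \o z)) ->
  (forall f0 : set_type (level S1) -> set_type (level S2),
     (forall z, set_val (f0 z) = F (set_val z)) ->
     continuous (fun z => glued_class (f0 z))) ->
  (forall g0 : set_type (level S2) -> set_type (level S1),
     (forall z, set_val (g0 z) = G (set_val z)) ->
     continuous (fun z => glued_class (g0 z))) ->
  topologically_conjugated (@flow R S1) (@flow R S2).
Proof.
move=> lF lG gF gG GF FG tF tG cF cG.
have lv (S : impact_system R) (z : set_type (level S)) : level S (set_val z).
  exact: set_valP.
pose f0 (z : set_type (level S1)) : set_type (level S2) :=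
  exist _ (F (set_val z)) (mem_set (lF _ (lv _ z))).
pose g0 (z : set_type (level S2)) : set_type (level S1) :=
  exist _ (G (set_val z)) (mem_set (lG _ (lv _ z))).
pose f (x : glued_level S1) : glued_level S2 := glued_class (f0 (generic_quotient.repr x)).
pose g (x : glued_level S2) : glued_level S1 := glued_class (g0 (generic_quotient.repr x)).
have fE z : f (glued_class z) = glued_class (f0 z).
  apply/glued_classP; rewrite /=; apply: gF => //.
  by apply/glued_classP; rewrite {1}/glued_class generic_quotient.reprK.
have gE z : g (glued_class z) = glued_class (g0 z).
  apply/glued_classP; rewrite /=; apply: gG => //.
  by apply/glued_classP; rewrite {1}/glued_class generic_quotient.reprK.
have fK : cancel f g.
  move=> x; have [z <-] := glued_class_surj x.
  by rewrite fE gE; apply/glued_classP; exact: GF.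
have gK : cancel g f.
  move=> x; have [z <-] := glued_class_surj x.
  by rewrite gE fE; apply/glued_classP; exact: FG.
exists f, g; split => //.
- apply/quotient_continuous.
  rewrite (_ : _ \o _ = fun z => glued_class (f0 z)); last first.
    by apply/funext => z /=; rewrite -fE.
  exact: cF.
- apply/quotient_continuous.
  rewrite (_ : _ \o _ = fun z => glued_class (g0 z)); last first.
    by apply/funext => z /=; rewrite -gE.
  exact: cG.
move=> t x y; split=> -[t0 [z [a [b [tz za ax zb bx]]]]]; split=> //.
  exists (F \o z), (f0 a), (f0 b); split; first exact: tF.
  - by rewrite /= za.
  - by rewrite -fE ax.
  - by rewrite /= zb.
  - by rewrite -fE bx.
exists (G \o z), (g0 a), (g0 b); split; first exact: tG.
- by rewrite /= za.
- by rewrite -gE ax fK.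
- by rewrite /= zb.
- by rewrite -gE bx fK.
Qed.

End Topology.

(** * The wall in the folded coordinate *)

Section Wall.
Variable R : realType.
Variables (w e qw : R).
Hypotheses (w_gt0 : 0 < w) (e_gt : hstep w qw < e).

Let E := Num.sqrt (2 * e).
Let th := theta_wall w e qw.

Lemma energy_gt0 : 0 < e.
Proof.
by apply: le_lt_trans e_gt; rewrite /hstep /oscillatorV divr_ge0// mulr_ge0// sqr_ge0.
Qed.

Let E_gt0 : 0 < E. Proof. by rewrite sqrtr_gt0 mulr_gt0// energy_gt0. Qed.
Let E2 : E ^+ 2 = 2 * e.
Proof. by rewrite sqr_sqrtr// mulr_ge0// ltW// energy_gt0. Qed.

Lemma wall_arg : -1 < w * qw / E < 1.
Proof.
rewrite -ltr_norml -(@ltr_pXn2r _ 2) ?nnegrE// expr1n -normrX ger0_norm ?sqr_ge0//.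
rewrite expr_div_n E2 ltr_pdivrMr ?mulr_gt0 ?energy_gt0// mul1r exprMn.
by move: e_gt; rewrite /hstep /oscillatorV; lra.
Qed.

Lemma wall_argW : -1 <= w * qw / E <= 1.
Proof. by case/andP: wall_arg => h1 h2; rewrite !ltW. Qed.

Lemma theta_wall_itv : 0 < th < pi.
Proof.
case/andP: wall_arg => h1 h2.
by rewrite /th /theta_wall acos_gt0 ?acos_ltpi// ?h1 ?h2 ltW.
Qed.

Lemma cos_theta_wall : cos th = w * qw / E.
Proof. by rewrite /th /theta_wall acosK// in_itv/= wall_argW. Qed.

Lemma qwallE : qw = E / w * cos th.
Proof. by rewrite cos_theta_wall; field; rewrite !gt_eqF. Qed.

Lemma fold_angle_le_wall q p : oscillatorH w q p = e ->
  (fold_angle w e q <= th) = (qw <= q).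
Proof.
move=> He; have [h _] := fold_angle_arg energy_gt0 He.
have hw := wall_argW.
rewrite /fold_angle /th /theta_wall (acos_le_mono (x := w * q / _)) ?in_itv//=.
by rewrite ler_pM2r ?invr_gt0// ler_pM2l.
Qed.

Lemma fold_angle_ge_wall q p : oscillatorH w q p = e ->
  (th <= fold_angle w e q) = (q <= qw).
Proof.
move=> He; have [h _] := fold_angle_arg energy_gt0 He.
have hw := wall_argW.
rewrite /fold_angle /th /theta_wall (acos_le_mono (y := w * q / _)) ?in_itv//=.
by rewrite ler_pM2r ?invr_gt0// ler_pM2l.
Qed.

Lemma fold_angle_eq_wall q p : oscillatorH w q p = e ->
  fold_angle w e q = th <-> q = qw.
Proof.
move=> He; split=> [fE|->//]; apply/eqP; rewrite eq_le.
by rewrite -(fold_angle_ge_wall He) -(fold_angle_le_wall He) fE lexx.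
Qed.

Lemma unfold_q_ge_wall (x : R) : 0 <= x <= pi -> (qw <= unfold_q w e x) = (x <= th).
Proof.
move=> xI; rewrite [in LHS]qwallE /unfold_q ler_pM2l ?divr_gt0// leNgt ltr_cos -?leNgt//.
by rewrite in_itv/=; case/andP: theta_wall_itv => *; rewrite !ltW.
Qed.

(** The energy exceeds the height of the step, so the wall is never reached at
    rest. *)
Lemma wall_speed : exists2 m : R, 0 < m &
  forall p, oscillatorH w qw p = e -> m <= `|p|.
Proof.
have m0 : 0 < 2 * (e - hstep w qw) by rewrite mulr_gt0// subr_gt0.
exists (Num.sqrt (2 * (e - hstep w qw))); first by rewrite sqrtr_gt0.
move=> p He; rewrite -sqrtr_sqr ler_wsqrtr//.
by rewrite -He /oscillatorH /hstep; lra.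
Qed.

Lemma fold_velocityN q p : p != 0 -> fold_velocity w q (- p) = - fold_velocity w q p.
Proof.
move=> p0; rewrite /fold_velocity oppr_eq0 (negbTE p0)/= !orbF oppr_lt0.
by case: ltrgtP p0 => //; rewrite ?opprK.
Qed.

(** Only the turning points have two velocities over one phase point, and these
    two velocities are exchanged by the bounce there. *)
Lemma fold_unfold_glue (x v : R) : 0 <= x <= pi -> v = w \/ v = - w ->
  fold_angle w e (unfold_q w e x) = x /\
  (fold_velocity w (unfold_q w e x) (unfold_p w e x v) = v \/
   (x = 0 \/ x = pi) /\
   fold_velocity w (unfold_q w e x) (unfold_p w e x v) = - v).
Proof.
move=> /andP[x0 xpi] vw.
have vwN : - v = w \/ - v = - w.
  by case: vw => ->; rewrite ?opprK; [right|left].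
have [[x0' xpi']|turn] : (0 < x /\ x < pi) \/ (x = 0 \/ x = pi).
  move: x0 xpi; rewrite le_eqVlt => /predU1P[<-|x0]; first by right; left.
  by rewrite le_eqVlt => /predU1P[->|xpi]; [right; right|left].
  have [//|-> ->] := fold_unfold w_gt0 energy_gt0 vw (x := x).
    by apply: Or31; rewrite x0' xpi'.
  by split=> //; left.
have [og|og] : outgoing w x v \/ outgoing w x (- v).
  case: turn vw => -> [] ->; rewrite ?opprK.
  - by left; apply: Or32.
  - by right; apply: Or32.
  - by right; apply: Or33.
  - by left; apply: Or33.
- by have [-> ->] := fold_unfold w_gt0 energy_gt0 vw og; split=> //; left.
have [-> fE] := fold_unfold w_gt0 energy_gt0 vwN og; split=> //; right.
by split=> //; rewrite -[RHS]fE !unfold_p_turn.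
Qed.

Lemma oscillator_force q : - derive1 (oscillatorV w) q = - (w ^+ 2 * q).
Proof.
congr (- _); rewrite derive1E.
have dq : is_derive q 1 (oscillatorV w) (w ^+ 2 * q).
  rewrite /oscillatorV.
  have -> : (fun q => w ^+ 2 * q ^+ 2 / 2) = (w ^+ 2 / 2) \*: (fun q : R => q ^+ 2).
    by apply/funext => x /=; rewrite /GRing.scale/=; ring.
  apply: is_derive_eq; rewrite /GRing.scale/=; by field.
by rewrite derive_val.
Qed.

End Wall.

Lemma local_motion_eq_hits (R : realType) (k : R) c sn T (hit hit' : set R) (q p : R -> R) :
  (forall t, 0 <= t <= T -> hit t <-> hit' t) ->
  local_motion k c sn T hit q p -> local_motion k c sn T hit' q p.
Proof.
move=> hh [mr ml]; split=> // t tT.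
have /hh e : 0 <= t <= T by case/andP: tT => /ltW -> ->.
by have := ml t tT; rewrite /incoming (asbool_equiv_eq e).
Qed.

(** * Conjugacy of the step system and the L-shaped billiard *)

Section StepSystem.
Variable R : realType.
Variables (w1 w2 q1w q2w e1 e2 : R).
Hypotheses (w1_gt0 : 0 < w1) (w2_gt0 : 0 < w2).
Hypotheses (e1_gt : hstep w1 q1w < e1) (e2_gt : hstep w2 q2w < e2).

Let a := theta_wall w1 e1 q1w.
Let b := theta_wall w2 e2 q2w.
Let S := step_system w1 w2 q1w q2w e1 e2.
Let B := L_billiard pi pi a b w1 w2.

Lemma step_trajectoryP T (z : R -> phase R) :
  trajectory S T z <->
  [/\ forall t, 0 <= t <= T -> level S (z t),
      forall t, 0 <= t < T -> (z t).1 <> corner S,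
      harmonic_motion w1 T [set t | side1 S (z t).1]
        (fun t => (z t).1.1) (fun t => (z t).2.1) &
      harmonic_motion w2 T [set t | side2 S (z t).1]
        (fun t => (z t).1.2) (fun t => (z t).2.2)].
Proof.
have [m1 m10 hm1] := wall_speed e1_gt; have [m2 m20 hm2] := wall_speed e2_gt.
have P1 : (forall t, 0 <= t <= T -> level S (z t)) ->
    elastic_coordinate T (force1 S) [set t | side1 S (z t).1]
        (fun t => (z t).1.1) (fun t => (z t).2.1) <->
    harmonic_motion w1 T [set t | side1 S (z t).1]
        (fun t => (z t).1.1) (fun t => (z t).2.1).
  move=> lz; apply: (elastic_coordinateP (harmonic_propagator (lt0r_neq0 w1_gt0)) _ m10).
  - by move=> x; exact: oscillator_force.
  - by move=> t /lz[_ + _] [qE _]; rewrite qE => /hm1.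
have P2 : (forall t, 0 <= t <= T -> level S (z t)) ->
    elastic_coordinate T (force2 S) [set t | side2 S (z t).1]
        (fun t => (z t).1.2) (fun t => (z t).2.2) <->
    harmonic_motion w2 T [set t | side2 S (z t).1]
        (fun t => (z t).1.2) (fun t => (z t).2.2).
  move=> lz; apply: (elastic_coordinateP (harmonic_propagator (lt0r_neq0 w2_gt0)) _ m20).
  - by move=> x; exact: oscillator_force.
  - by move=> t /lz[_ _ +] [_ qE]; rewrite qE => /hm2.
by split=> -[lz cz h1 h2]; split=> //; [exact/P1|exact/P2|exact/P1|exact/P2].
Qed.

Lemma billiard_trajectoryP T (z : R -> phase R) :
  trajectory B T z <->
  [/\ forall t, 0 <= t <= T -> level B (z t),
      forall t, 0 <= t < T -> (z t).1 <> corner B,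
      free_motion T [set t | side1 B (z t).1]
        (fun t => (z t).1.1) (fun t => (z t).2.1) &
      free_motion T [set t | side2 B (z t).1]
        (fun t => (z t).1.2) (fun t => (z t).2.2)].
Proof.
have vE (w v : R) : 0 < w -> v = w \/ v = - w -> w <= `|v|.
  by move=> w0 [] ->; rewrite ?normrN gtr0_norm.
have P1 : (forall t, 0 <= t <= T -> level B (z t)) ->
    elastic_coordinate T (force1 B) [set t | side1 B (z t).1]
        (fun t => (z t).1.1) (fun t => (z t).2.1) <->
    free_motion T [set t | side1 B (z t).1]
        (fun t => (z t).1.1) (fun t => (z t).2.1).
  move=> lz; apply: (elastic_coordinateP (free_propagator R) _ w1_gt0).
  - by move=> x; rewrite mul0r oppr0.
  - by move=> t /lz[_ + _] _; exact: vE.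
have P2 : (forall t, 0 <= t <= T -> level B (z t)) ->
    elastic_coordinate T (force2 B) [set t | side2 B (z t).1]
        (fun t => (z t).1.2) (fun t => (z t).2.2) <->
    free_motion T [set t | side2 B (z t).1]
        (fun t => (z t).1.2) (fun t => (z t).2.2).
  move=> lz; apply: (elastic_coordinateP (free_propagator R) _ w2_gt0).
  - by move=> x; rewrite mul0r oppr0.
  - by move=> t /lz[_ _ +] _; exact: vE.
by split=> -[lz cz h1 h2]; split=> //; [exact/P1|exact/P2|exact/P1|exact/P2].
Qed.

Definition fold_phase (z : phase R) : phase R :=
  ((fold_angle w1 e1 z.1.1, fold_angle w2 e2 z.1.2),
   (fold_velocity w1 z.1.1 z.2.1, fold_velocity w2 z.1.2 z.2.2)).

Definition unfold_phase (y : phase R) : phase R :=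
  ((unfold_q w1 e1 y.1.1, unfold_q w2 e2 y.1.2),
   (unfold_p w1 e1 y.1.1 y.2.1, unfold_p w2 e2 y.1.2 y.2.2)).

Let e1_gt0 : 0 < e1 := energy_gt0 e1_gt.
Let e2_gt0 : 0 < e2 := energy_gt0 e2_gt.

Lemma not_step (q : R * R) : (~` step q1w q2w) q <-> q1w <= q.1 \/ q2w <= q.2.
Proof.
split=> [/not_andP[]/negP|[] h []]; rewrite ?leNgt ?ltNge ?h//.
- by left.
- by right.
Qed.

Lemma level_fold z : level S z -> level B (fold_phase z).
Proof.
move=> [/not_step zs h1 h2]; split; last 2 first.
- exact: fold_velocityE.
- exact: fold_velocityE.
split; [exact: (fold_angle_itv e1_gt0 h1)|exact: (fold_angle_itv e2_gt0 h2)|].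
by rewrite (fold_angle_le_wall w1_gt0 e1_gt h1) (fold_angle_le_wall w2_gt0 e2_gt h2).
Qed.

Lemma level_unfold y : level B y -> level S (unfold_phase y).
Proof.
move=> [[x1 x2 xL] v1 v2]; split.
- by apply/not_step; rewrite /= (unfold_q_ge_wall w1_gt0 e1_gt)// (unfold_q_ge_wall w2_gt0 e2_gt).
- exact: unfold_H.
- exact: unfold_H.
Qed.

Lemma side1_fold z : level S z -> side1 B (fold_phase z).1 <->
  side1 S z.1 \/ (fold_angle w1 e1 z.1.1 = 0 \/ fold_angle w1 e1 z.1.1 = pi).
Proof.
move=> [_ h1 h2]; rewrite /= -/a -/b (fold_angle_ge_wall w2_gt0 e2_gt h2).
have := fold_angle_eq_wall w1_gt0 e1_gt h1; rewrite -/a => E.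
split=> [[?|?|[/E ? ?]]|[[/E ? ?]|[?|?]]].
- by right; left.
- by right; right.
- by left.
- exact: Or33.
- exact: Or31.
- exact: Or32.
Qed.

Lemma side2_fold z : level S z -> side2 B (fold_phase z).1 <->
  side2 S z.1 \/ (fold_angle w2 e2 z.1.2 = 0 \/ fold_angle w2 e2 z.1.2 = pi).
Proof.
move=> [_ h1 h2]; rewrite /= -/a -/b (fold_angle_ge_wall w1_gt0 e1_gt h1).
have := fold_angle_eq_wall w2_gt0 e2_gt h2; rewrite -/b => E.
split=> [[?|?|[/E ? ?]]|[[? /E ?]|[?|?]]].
- by right; left.
- by right; right.
- by left.
- exact: Or33.
- exact: Or31.
- exact: Or32.
Qed.

Lemma corner_fold z : level S z -> (fold_phase z).1 = corner B <-> z.1 = corner S.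
Proof.
move=> [_ h1 h2]; have E1 := fold_angle_eq_wall w1_gt0 e1_gt h1.
have E2 := fold_angle_eq_wall w2_gt0 e2_gt h2.
by case: z h1 h2 E1 E2 => -[q1 q2] [p1 p2] /= h1 h2 E1 E2; split=> -[/E1-> /E2->].
Qed.

Lemma unfold_fold z : level S z -> unfold_phase (fold_phase z) = z.
Proof.
move=> [_ h1 h2]; rewrite /unfold_phase /=.
rewrite (unfold_q_fold w1_gt0 e1_gt0 h1) (unfold_q_fold w2_gt0 e2_gt0 h2).
rewrite (unfold_p_fold w1_gt0 e1_gt0 h1) (unfold_p_fold w2_gt0 e2_gt0 h2).
by case: z {h1 h2} => -[? ?] [].
Qed.

Lemma unfold_fold_angle y : level B y -> (fold_phase (unfold_phase y)).1 = y.1.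
Proof.
move=> [[x1 x2 _] v1 v2]; rewrite /=.
rewrite (fold_unfold_glue w1_gt0 e1_gt x1 v1).1 (fold_unfold_glue w2_gt0 e2_gt x2 v2).1.
by case: (y.1).
Qed.

Lemma fold_unfold_glued y : level B y -> glued B (fold_phase (unfold_phase y)) y.
Proof.
move=> ly; have [[x1 x2 _] v1 v2] := ly.
split; rewrite unfold_fold_angle //=.
  have [_ [->|[turn ->]]] := fold_unfold_glue w1_gt0 e1_gt x1 v1; first by left.
  by right; rewrite opprK; split=> //; case: turn; [constructor 1|constructor 2].
have [_ [->|[turn ->]]] := fold_unfold_glue w2_gt0 e2_gt x2 v2; first by left.
by right; rewrite opprK; split=> //; case: turn; [constructor 1|constructor 2].
Qed.

(** An impact reverses the momentum, hence the folded velocity, unless the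
    momentum vanishes and nothing is reversed. *)
Lemma glued_fold z z' : level S z -> level S z' -> glued S z z' ->
  glued B (fold_phase z) (fold_phase z').
Proof.
move=> lz lz' [zE h1 h2]; rewrite /fold_phase -zE; split=> //=.
  case: h1 => [->|[s1 ->]]; first by left.
  have [->|p0] := eqVneq z.2.1 0; first by rewrite oppr0; left.
  right; rewrite fold_velocityN//; split=> //.
  by apply/(side1_fold lz); left.
case: h2 => [->|[s2 ->]]; first by left.
have [->|p0] := eqVneq z.2.2 0; first by rewrite oppr0; left.
right; rewrite fold_velocityN//; split=> //.
by apply/(side2_fold lz); left.
Qed.

Lemma side1_unfold y : level B y -> side1 B y.1 <->
  side1 S (unfold_phase y).1 \/ (y.1.1 = 0 \/ y.1.1 = pi).
Proof.
move=> ly; have := side1_fold (level_unfold ly); rewrite unfold_fold_angle//.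
by have /(congr1 fst)/= -> := unfold_fold_angle ly.
Qed.

Lemma side2_unfold y : level B y -> side2 B y.1 <->
  side2 S (unfold_phase y).1 \/ (y.1.2 = 0 \/ y.1.2 = pi).
Proof.
move=> ly; have := side2_fold (level_unfold ly); rewrite unfold_fold_angle//.
by have /(congr1 snd)/= -> := unfold_fold_angle ly.
Qed.

Lemma glued_unfold y y' : level B y -> level B y' -> glued B y y' ->
  glued S (unfold_phase y) (unfold_phase y').
Proof.
move=> ly ly' [yE h1 h2]; rewrite /unfold_phase -yE; split=> //=.
  case: h1 => [->|[s1 ->]]; first by left.
  rewrite unfold_pN; have /(side1_unfold ly)[s|turn] := s1; first by right.
  by left; rewrite unfold_p_turn// oppr0.
case: h2 => [->|[s2 ->]]; first by left.
rewrite unfold_pN; have /(side2_unfold ly)[s|turn] := s2; first by right.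
by left; rewrite unfold_p_turn// oppr0.
Qed.

Lemma trajectory_fold T (z : R -> phase R) :
  trajectory S T z -> trajectory B T (fold_phase \o z).
Proof.
move=> /step_trajectoryP[lz cz h1 h2]; apply/billiard_trajectoryP; split.
- by move=> t /lz /level_fold.
- move=> t tT; have /lz lt : 0 <= t <= T by case/andP: tT => -> /ltW ->.
  by move=> /(corner_fold lt); exact: cz.
- have H1 t : 0 <= t <= T -> oscillatorH w1 (z t).1.1 (z t).2.1 = e1 by move=> /lz[].
  apply: local_motion_eq_hits (motion_fold w1_gt0 e1_gt0 H1 h1) => t /lz/side1_fold[? ?].
  by split.
- have H2 t : 0 <= t <= T -> oscillatorH w2 (z t).1.2 (z t).2.2 = e2 by move=> /lz[].
  apply: local_motion_eq_hits (motion_fold w2_gt0 e2_gt0 H2 h2) => t /lz/side2_fold[? ?].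
  by split.
Qed.

Lemma trajectory_unfold T (y : R -> phase R) :
  trajectory B T y -> trajectory S T (unfold_phase \o y).
Proof.
move=> /billiard_trajectoryP[ly cy h1 h2]; apply/step_trajectoryP; split.
- by move=> t /ly /level_unfold.
- move=> t tT; have /ly lt : 0 <= t <= T by case/andP: tT => -> /ltW ->.
  move=> /(corner_fold (level_unfold lt)); rewrite unfold_fold_angle//.
  exact: cy.
- apply: (motion_unfold e1 w1_gt0 (x := fun t => (y t).1.1)
    (v := fun t => (y t).2.1)).
    by move=> t /ly[].
  by apply: local_motion_eq_hits h1 => t /ly/side1_unfold[? ?]; split.
- apply: (motion_unfold e2 w2_gt0 (x := fun t => (y t).1.2)
    (v := fun t => (y t).2.2)).
    by move=> t /ly[].
  by apply: local_motion_eq_hits h2 => t /ly/side2_unfold[? ?]; split.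
Qed.

Lemma continuous_pair (T U V : topologicalType) (f : T -> U) (g : T -> V) :
  continuous f -> continuous g -> continuous (fun x => (f x, g x)).
Proof. by move=> cf cg x; apply: cvg_pair; [exact: cf|exact: cg]. Qed.

Lemma continuous_unfold_q (X : topologicalType) (w e : R) (x : X -> R) :
  continuous x -> continuous (fun y => unfold_q w e (x y)).
Proof.
move=> cx y; apply: cvgM; first exact: cvg_cst.
exact: (@continuous_comp _ _ _ x (@cos R) y (cx y) (@continuous_cos R _)).
Qed.

Lemma continuous_unfold_p (X : topologicalType) (w e : R) (x v : X -> R) :
  continuous x -> continuous v -> continuous (fun y => unfold_p w e (x y) (v y)).
Proof.
move=> cx cv y; apply: cvgN; apply: cvgM; last first.
  by apply: cvgM; [exact: cv|exact: cvg_cst].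
apply: cvgM; first exact: cvg_cst.
exact: (@continuous_comp _ _ _ x (@sin R) y (cx y) (@continuous_sin R _)).
Qed.

Lemma continuous_fold_angle (X : topologicalType) (w e : R) (q p : X -> R) :
  0 < e -> (forall z, oscillatorH w (q z) (p z) = e) -> continuous q ->
  continuous (fun z => fold_angle w e (q z)).
Proof.
move=> e0 H cq; apply: continuous_acos_comp.
  move=> z; apply: cvgM; last exact: cvg_cst.
  by apply: cvgM; [exact: cvg_cst|exact: cq].
by move=> z; have [] := fold_angle_arg e0 (H z).
Qed.

Lemma continuous_coordinates (A : set (phase R)) :
  [/\ continuous (fun z : set_type A => (set_val z).1.1),
      continuous (fun z : set_type A => (set_val z).1.2),
      continuous (fun z : set_type A => (set_val z).2.1) &
      continuous (fun z : set_type A => (set_val z).2.2)].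
Proof.
have cv : continuous (set_val : set_type A -> phase R) by exact: initial_continuous.
have pr1 (U V X : topologicalType) (f : X -> U * V) :
    continuous f -> continuous (fun x => (f x).1).
  by move=> cf x; apply: (continuous_comp (cf x)); exact: cvg_fst.
have pr2 (U V X : topologicalType) (f : X -> U * V) :
    continuous f -> continuous (fun x => (f x).2).
  by move=> cf x; apply: (continuous_comp (cf x)); exact: cvg_snd.
split.
- exact: pr1 (pr1 _ _ _ _ cv).
- exact: pr2 (pr1 _ _ _ _ cv).
- exact: pr1 (pr2 _ _ _ _ cv).
- exact: pr2 (pr2 _ _ _ _ cv).
Qed.

Lemma continuous_unfold (g0 : set_type (level B) -> set_type (level S)) :
  (forall y, set_val (g0 y) = unfold_phase (set_val y)) ->
  continuous (fun y => glued_class (g0 y)).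
Proof.
move=> g0E; have [c1 c2 c3 c4] := continuous_coordinates (level B).
have cg : continuous g0.
  apply: continuous_comp_initial.
  rewrite (_ : _ \o _ = unfold_phase \o set_val); last by apply/funext => y /=.
  by do 2?[apply: continuous_pair]; [exact: continuous_unfold_q|exact: continuous_unfold_q
    |exact: continuous_unfold_p|exact: continuous_unfold_p].
by move=> y; apply: (continuous_comp (cg y)); exact: glued_class_continuous.
Qed.

Lemma fold_angle_turn (w e q p : R) : 0 < w -> 0 < e -> oscillatorH w q p = e ->
  p = 0 -> fold_angle w e q = 0 \/ fold_angle w e q = pi.
Proof.
move=> w0 e0 He p0; have [/sin_gt0_pi|[]|[]] := outgoing_fold w0 e0 He; [|by left|by right].
by rewrite (fold_angle_arg e0 He).2 p0 normr0 mul0r ltxx.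
Qed.

(** The phase space is cut along the signs of the two momenta.  On each piece the
    velocity may be taken constant: it differs from the folded one only where the
    momentum vanishes, and there the billiard glueing identifies them. *)
Lemma continuous_fold (f0 : set_type (level S) -> set_type (level B)) :
  (forall z, set_val (f0 z) = fold_phase (set_val z)) ->
  continuous (fun z => glued_class (f0 z)).
Proof.
move=> f0E; have [c1 c2 c3 c4] := continuous_coordinates (level S).
have lv (z : set_type (level S)) : level S (set_val z) by exact: set_valP.
pose sgw (s : bool) (w : R) := if s then w else - w.
pose half (s : bool) (p : R) := if s then p <= 0 else 0 <= p.
pose F (i : bool * bool) (z : set_type (level S)) : phase R :=
  ((fold_phase (set_val z)).1, (sgw i.1 w1, sgw i.2 w2)).
have lF i z : level B (F i z).
  have [L _ _] := level_fold (lv z); split=> //=.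
    by rewrite /sgw; case: i.1; [left|right].
  by rewrite /sgw; case: i.2; [left|right].
pose f i z : set_type (level B) := exist _ (F i z) (mem_set (lF i z)).
apply: (@closed_cover_continuous _ _ _
  (fun i : bool * bool => [set z : set_type (level S) |
     half i.1 (set_val z).2.1 /\ half i.2 (set_val z).2.2]) _
  (fun i z => glued_class (f i z))).
- have ch s (p : set_type (level S) -> R) : continuous p -> closed [set z | half s (p z)].
    move=> cp; case: s; rewrite /half.
      by apply: (@closed_comp _ _ p [set x | x <= 0]) => //; exact: closed_le.
    by apply: (@closed_comp _ _ p [set x | 0 <= x]) => //; exact: closed_ge.
  by move=> i; apply: closedI; exact: ch.
- move=> z; exists ((set_val z).2.1 <= 0, (set_val z).2.2 <= 0) => /=.
  by rewrite /half; split; case: ifPn => //; rewrite -ltNge => /ltW.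
- move=> i; have cf : continuous (f i).
    apply: continuous_comp_initial.
    rewrite (_ : _ \o _ = F i); last by apply/funext.
    apply: continuous_pair; last exact: cst_continuous.
    apply: continuous_pair.
      apply: (@continuous_fold_angle _ _ _ _
        (fun z : set_type (level S) => (set_val z).2.1)) => // z.
      by case: (lv z).
    apply: (@continuous_fold_angle _ _ _ _
      (fun z : set_type (level S) => (set_val z).2.2)) => // z.
    by case: (lv z).
  by move=> z; apply: (continuous_comp (cf z)); exact: glued_class_continuous.
- move=> i z [/= s1 s2]; have lz := lv z; have [_ h1 h2] := lz.
  have key (w e q p : R) s : 0 < w -> 0 < e -> oscillatorH w q p = e -> half s p ->
      sgw s w = fold_velocity w q p \/
      (fold_angle w e q = 0 \/ fold_angle w e q = pi) /\
      sgw s w = - fold_velocity w q p.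
    move=> w0 e0 He; have [p0|p0] := eqVneq p 0.
      have turn := fold_angle_turn w0 e0 He p0.
      by rewrite /sgw /fold_velocity; case: s; case: ifP; rewrite ?opprK; by [left|right].
    rewrite /half /sgw /fold_velocity (negbTE p0)/= orbF.
    case: s; first by rewrite le_eqVlt (negbTE p0) /= => ->; left.
    by move=> p0'; rewrite ltNge p0'; left.
  apply: (proj2 (@glued_classP R B _ _)); rewrite f0E; split=> //=.
    have [->|[turn ->]] := key _ _ _ _ _ w1_gt0 e1_gt0 h1 s1; first by left.
    by right; split=> //; apply/(side1_fold lz); right.
  have [->|[turn ->]] := key _ _ _ _ _ w2_gt0 e2_gt0 h2 s2; first by left.
  by right; split=> //; apply/(side2_fold lz); right.
Qed.

Theorem step_billiard_conjugacy :
  topologically_conjugated (@flow R S) (@flow R B).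
Proof.
apply: (@conjugated_by_phase_map R S B fold_phase unfold_phase).
- exact: level_fold.
- exact: level_unfold.
- exact: glued_fold.
- exact: glued_unfold.
- by move=> z lz; rewrite unfold_fold//; split=> //; left.
- exact: fold_unfold_glued.
- exact: trajectory_fold.
- exact: trajectory_unfold.
- exact: continuous_fold.
- exact: continuous_unfold.
Qed.

End StepSystem.

(** * Smoothness and monotonicity of the arm widths *)

Section Directional.
Variable R : realType.
Implicit Types (f g : R * R -> R) (u v : R * R).

(** Directional derivatives are derivatives along a line, which gives access to
    the one-variable chain rule. *)
Lemma is_derive_line f u v (d : R) :
  is_derive u v f d <-> is_derive (0 : R) 1 (fun h : R => f (h *: v + u)) d.
Proof.
have E : 'D_v f u = 'D_1 (fun h : R => f (h *: v + u)) 0.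
  rewrite /derive; set g1 := fun h => h^-1 *: _; set g2 := fun h => h^-1 *: _.
  suff -> : g1 = g2 by [].
  by apply/funext => h; rewrite /g1 /g2 /= addr0 scale0r add0r [h%:A]mulr1.
split=> -[df dE]; split.
- by have [+ _] := derivable1P f u v; apply.
- by rewrite -E.
- by have [_] := derivable1P f u v; apply.
- by rewrite E.
Qed.

Lemma is_derive_fst u v : is_derive u v (fst : R * R -> R) v.1.
Proof.
apply/is_derive_line.
rewrite (_ : (fun h => _) = fun h : R => h * v.1 + u.1); last by apply/funext.
by apply: is_derive_eq; rewrite /GRing.scale/=; ring.
Qed.

Lemma is_derive_snd u v : is_derive u v (snd : R * R -> R) v.2.
Proof.
apply/is_derive_line.
rewrite (_ : (fun h => _) = fun h : R => h * v.2 + u.2); last by apply/funext.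
by apply: is_derive_eq; rewrite /GRing.scale/=; ring.
Qed.

Lemma is_derive_chain (phi : R -> R) f u v (d l : R) :
  is_derive u v f d -> is_derive (f u) 1 phi l ->
  is_derive u v (fun x => phi (f x)) (l * d).
Proof.
move=> /is_derive_line df dphi; apply/is_derive_line.
apply: (@is_derive1_comp _ phi (fun h : R => f (h *: v + u))) => //.
by rewrite scale0r add0r.
Qed.

Lemma is_derive_prod f g u v (df dg : R) :
  is_derive u v f df -> is_derive u v g dg ->
  is_derive u v (fun x => f x * g x) (f u * dg + g u * df).
Proof. by move=> hf hg; apply: is_deriveM. Qed.

Lemma is_derive_sum f g u v (df dg : R) :
  is_derive u v f df -> is_derive u v g dg ->
  is_derive u v (fun x => f x + g x) (df + dg).
Proof. by move=> hf hg; apply: is_deriveD. Qed.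

Lemma is_derive_recip f u v (df : R) : f u != 0 -> is_derive u v f df ->
  is_derive u v (fun x => (f x)^-1) (- (f u) ^- 2 * df).
Proof.
move=> f0 hf.
have dV := @is_deriveV R id (f u) _ 1 f0 (is_derive_id (f u) 1).
by apply: (is_derive_eq (is_derive_chain hf dV)); rewrite /GRing.scale/= mulr1.
Qed.

Lemma Cn_on_eq (U : set (R * R)) n f g : open U -> (forall u, U u -> f u = g u) ->
  Cn_on n U f -> Cn_on n U g.
Proof.
move=> oU; elim: n f g => [|n IH] f g fg /=.
  move=> cf u Uu; have nE : \forall x \near u, f x = g x.
    by move: oU; rewrite openE => /(_ _ Uu); apply: filterS => x /fg.
  rewrite /prop_for /continuous_at -(fg u Uu).
  by apply: cvg_trans (cf u Uu); apply: near_eq_cvg.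
have nE u : U u -> \forall x \near u, f x = g x.
  by move=> Uu; move: oU; rewrite openE => /(_ _ Uu); apply: filterS => x /fg.
move=> [df c1 c2]; split.
- move=> u Uu; have [d1 d2] := df u Uu.
  by split; [apply: near_eq_derivable d1|apply: near_eq_derivable d2]; exact: nE.
- by apply: IH c1 => u Uu; apply: near_eq_derive; exact: nE.
- by apply: IH c2 => u Uu; apply: near_eq_derive; exact: nE.
Qed.

(** Partial derivatives stay in [K], so the iteration defining C^n never leaves it. *)
Lemma smooth_on_closed (U : set (R * R)) (K : (R * R -> R) -> Prop) : open U ->
  (forall f u, K f -> U u -> {for u, continuous f}) ->
  (forall f v, K f -> exists2 g, K g & forall u, U u -> is_derive u v f (g u)) ->
  forall f, K f -> smooth_on U f.
Proof.
move=> oU Kc Kd f Kf n; elim: n f Kf => [|n IH] f Kf /=; first by move=> u; exact: Kc.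
have [g1 K1 d1] := Kd _ (1, 0) Kf; have [g2 K2 d2] := Kd _ (0, 1) Kf.
split.
- by move=> u Uu; split; [have [] := d1 u Uu|have [] := d2 u Uu].
- apply: (Cn_on_eq oU _ (IH _ K1)) => u Uu; have := d1 u Uu => ?.
  by rewrite derive_val.
- apply: (Cn_on_eq oU _ (IH _ K2)) => u Uu; have := d2 u Uu => ?.
  by rewrite derive_val.
Qed.

End Directional.

Section ThetaSmooth.
Variable R : realType.
Variable w : R.
Hypothesis w_gt0 : 0 < w.

Let U : set (R * R) := [set u | hstep w u.2 < u.1].
Let gap (u : R * R) : R := 2 * u.1 + (- w ^+ 2) * (u.2 * u.2).
Let rgap (u : R * R) : R := (Num.sqrt (gap u))^-1.

(** With s = sqrt (2 e - w^2 q^2) one has D(1/e) = - (1/e)^2 de and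
    D(1/s) = (1/s)^3 (w^2 q dq - de), so these generators span an algebra stable
    under differentiation. *)
Inductive wall_algebra : (R * R -> R) -> Prop :=
| wall_cst k : wall_algebra (fun=> k)
| wall_snd : wall_algebra snd
| wall_inv_energy : wall_algebra (fun u => (u.1)^-1)
| wall_rgap : wall_algebra rgap
| wall_add f g : wall_algebra f -> wall_algebra g -> wall_algebra (fun u => f u + g u)
| wall_mul f g : wall_algebra f -> wall_algebra g -> wall_algebra (fun u => f u * g u).

Let gap_gt0 u : U u -> 0 < gap u.
Proof. by rewrite /U /gap /= /hstep /oscillatorV expr2; lra. Qed.

Let energy_pos u : U u -> 0 < u.1.
Proof. exact: energy_gt0. Qed.

Let is_derive_gap u v : is_derive u v gap (2 * v.1 + (- w ^+ 2) * (2 * (u.2 * v.2))).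
Proof.
have d1 := is_derive_fst u v; have d2 := is_derive_snd u v.
have := is_derive_sum (is_derive_prod (is_derive_cst (2 : R) u v) d1)
  (is_derive_prod (is_derive_cst (- w ^+ 2) u v) (is_derive_prod d2 d2)).
by move=> /is_derive_eq; apply; rewrite /=; ring.
Qed.

Let is_derive_rgap u v : U u ->
  is_derive u v rgap (rgap u * (rgap u * (rgap u * (- v.1 + w ^+ 2 * v.2 * u.2)))).
Proof.
move=> Uu; have g0 := gap_gt0 Uu.
have s0 : Num.sqrt (gap u) != 0 by rewrite gt_eqF// sqrtr_gt0.
have ds := is_derive_chain (is_derive_gap u v) (is_derive1_sqrt g0).
have dr := is_derive_recip s0 ds.
by apply: (is_derive_eq dr); rewrite /rgap /GRing.scale/=; field.
Qed.

Lemma continuous_gap : continuous gap.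
Proof.
move=> u; apply: cvgD; apply: cvgM; try exact: cvg_cst; first exact: cvg_fst.
by apply: cvgM; exact: cvg_snd.
Qed.

Lemma wall_algebra_continuous f u : wall_algebra f -> U u -> {for u, continuous f}.
Proof.
move=> Kf Uu; elim: Kf => {f} [k| | | |f g _ cf _ cg|f g _ cf _ cg].
- exact: cvg_cst.
- exact: cvg_snd.
- by apply: cvgV; [rewrite gt_eqF// energy_pos|exact: cvg_fst].
- apply: cvgV; first by rewrite gt_eqF// sqrtr_gt0 gap_gt0.
  apply: (@continuous_comp _ _ _ gap (@Num.sqrt R)); first exact: continuous_gap.
  exact: sqrt_continuous.
- by apply: cvgD; [exact: cf|exact: cg].
- by apply: cvgM; [exact: cf|exact: cg].
Qed.

Lemma wall_algebra_derive f v : wall_algebra f ->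
  exists2 g, wall_algebra g & forall u, U u -> is_derive u v f (g u).
Proof.
elim=> {f} [k| | | |f g Kf [f' Kf' df] Kg [g' Kg' dg]|f g Kf [f' Kf' df] Kg [g' Kg' dg]].
- by exists (fun=> 0) => [|u _]; [exact: wall_cst|exact: is_derive_cst].
- by exists (fun=> v.2) => [|u _]; [exact: wall_cst|exact: is_derive_snd].
- exists (fun u => - v.1 * (u.1^-1 * u.1^-1)).
    do !apply: wall_mul; [exact: wall_cst|exact: wall_inv_energy..].
  move=> u Uu; have u0 : u.1 != 0 by rewrite gt_eqF// energy_pos.
  have dr := is_derive_recip u0 (is_derive_fst u v).
  by apply: (is_derive_eq dr); rewrite /GRing.scale/=; field.
- exists (fun u => rgap u * (rgap u * (rgap u * (- v.1 + w ^+ 2 * v.2 * u.2)))).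
    do 3!(apply: wall_mul; first exact: wall_rgap).
    apply: wall_add; first exact: wall_cst.
    by apply: wall_mul; [exact: wall_cst|exact: wall_snd].
  by move=> u; exact: is_derive_rgap.
- exists (fun u => f' u + g' u); first exact: wall_add.
  by move=> u Uu; apply: is_derive_sum; [exact: df|exact: dg].
- exists (fun u => f u * g' u + g u * f' u).
    by apply: wall_add; apply: wall_mul.
  by move=> u Uu; apply: is_derive_prod; [exact: df|exact: dg].
Qed.

Let open_U : open U.
Proof.
rewrite (_ : U = gap @^-1` [set x | 0 < x]).
  by apply: open_comp; [move=> u _; exact: continuous_gap|exact: open_gt].
apply/seteqP; split=> u /=; first exact: gap_gt0.
by rewrite /U /gap /= /hstep /oscillatorV expr2; lra.
Qed.

Let theta (u : R * R) : R := theta_wall w u.1 u.2.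

Let is_derive_theta u v : U u -> is_derive u v theta
  (rgap u * (- w * v.2 + w * v.1 / 2 * (u.2 * u.1^-1))).
Proof.
move=> Uu; have e0 := energy_pos Uu; have g0 := gap_gt0 Uu.
have e20 : 0 < 2 * u.1 by rewrite mulr_gt0.
have E0 : Num.sqrt (2 * u.1) != 0 by rewrite gt_eqF// sqrtr_gt0.
have d1 := is_derive_fst u v; have d2 := is_derive_snd u v.
have d2e := is_derive_prod (is_derive_cst (2 : R) u v) d1.
have dsq := is_derive_chain d2e (is_derive1_sqrt e20).
have dinv := is_derive_recip E0 dsq.
have dwq := is_derive_prod (is_derive_cst w u v) d2.
have darg := is_derive_prod dwq dinv.
have dac := is_derive_chain darg (is_derive1_acos (wall_arg (w := w) (e := u.1) (qw := u.2) Uu)).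
apply: (is_derive_eq dac) => {dac darg dwq dinv dsq d2e d1 d2}.
have -> : 1 - (w * u.2 / Num.sqrt (2 * u.1)) ^+ 2 = gap u / (2 * u.1).
  rewrite !expr_div_n sqr_sqrtr ?ltW// /gap; field; by rewrite gt_eqF.
have s0 : Num.sqrt (gap u) != 0 by rewrite gt_eqF// sqrtr_gt0.
rewrite sqrtrM ?ltW// sqrtrV ?ltW// /rgap /GRing.scale/=.
have E2 : u.1 = Num.sqrt (2 * u.1) ^+ 2 / 2.
  by rewrite sqr_sqrtr ?ltW//; field.
set E := Num.sqrt (2 * u.1) in E0 E2 *.
by rewrite E2; field; rewrite E0.
Qed.

Lemma theta_wall_smooth : smooth_on U theta.
Proof.
have Kd v : wall_algebra (fun u => rgap u * (- w * v.2 + w * v.1 / 2 * (u.2 * u.1^-1))).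
  apply: wall_mul; first exact: wall_rgap.
  apply: wall_add; first exact: wall_cst.
  apply: wall_mul; first exact: wall_cst.
  by apply: wall_mul; [exact: wall_snd|exact: wall_inv_energy].
pose K f := wall_algebra f \/ f = theta.
apply: (smooth_on_closed (K := K)) => //; last by right.
- move=> f u [Kf|->] Uu; first exact: wall_algebra_continuous.
  rewrite (_ : theta = @acos R \o (fun u => w * u.2 / Num.sqrt (2 * u.1)))//.
  apply: continuous_comp.
    have e20 : 0 < 2 * u.1 by rewrite mulr_gt0// energy_pos.
    apply: cvgM; first by apply: cvgM; [exact: cvg_cst|exact: cvg_snd].
    apply: cvgV; first by rewrite gt_eqF// sqrtr_gt0.
    apply: continuous_cvg; first exact: sqrt_continuous.
    by apply: cvgM; [exact: cvg_cst|exact: cvg_fst].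
  by apply: continuous_acos; exact: wall_arg.
- move=> f v [Kf|->].
    by have [g Kg dg] := wall_algebra_derive v Kf; exists g => //; left.
  by eexists; [left; exact: (Kd v)|move=> u Uu; exact: is_derive_theta].
Qed.

End ThetaSmooth.

Section ThetaMonotone.
Variable R : realType.
Variable w : R.
Hypothesis w_gt0 : 0 < w.

Lemma theta_wall_lt e e' q q' : hstep w q < e -> hstep w q' < e' ->
  w * q / Num.sqrt (2 * e) < w * q' / Num.sqrt (2 * e') ->
  theta_wall w e' q' < theta_wall w e q.
Proof.
move=> he he' lt; rewrite /theta_wall ltNge acos_le_mono -?ltNge//.
  by rewrite in_itv/=; exact: (wall_argW he).
by rewrite in_itv/=; exact: (wall_argW he').
Qed.

Lemma theta_wall_increasing (q : R) : 0 < q ->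
  increasing_on [set e | hstep w q < e] (fun e => theta_wall w e q).
Proof.
move=> q0 e e' /= he he' ee'; apply: theta_wall_lt => //.
have e0 := energy_gt0 he; have e0' := energy_gt0 he'.
rewrite ltr_pM2l ?mulr_gt0// ltf_pV2 ?posrE ?sqrtr_gt0 ?mulr_gt0//.
by rewrite ltr_sqrt ?mulr_gt0// ltr_pM2l.
Qed.

Lemma theta_wall_decreasing (q : R) : q < 0 ->
  decreasing_on [set e | hstep w q < e] (fun e => theta_wall w e q).
Proof.
move=> q0 e e' /= he he' ee'; apply: theta_wall_lt => //.
have e0 := energy_gt0 he; have e0' := energy_gt0 he'.
rewrite ltr_nM2l ?nmulr_llt0// ?pmulr_rlt0//.
rewrite ltf_pV2 ?posrE ?sqrtr_gt0 ?mulr_gt0// ltr_sqrt ?mulr_gt0// ltr_pM2l//.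
Qed.

Lemma theta_wall_decreasing_wall (e : R) :
  decreasing_on [set q | hstep w q < e] (fun q => theta_wall w e q).
Proof.
move=> q q' /= he he' qq'; apply: theta_wall_lt => //.
have e0 := energy_gt0 he.
by rewrite ltr_pM2r ?invr_gt0 ?sqrtr_gt0 ?mulr_gt0// ltr_pM2l.
Qed.

End ThetaMonotone.

(** The first width varies with the sign of [q1w], the second one against the sign
    of [q2w] as its energy is [h - e1].  For the converse the energy interval must
    contain two points, as otherwise every function on it is both increasing and
    decreasing. *)
Lemma opposite_monotonicity_walls (R : realType) (w1 w2 q1w q2w h : R) :
  0 < w1 -> 0 < w2 -> q1w * q2w != 0 -> hstep w1 q1w + hstep w2 q2w < h ->
  opposite_monotonicity_on
    [set e1 | Rc w1 w2 q1w q2w h (e1, h - e1)]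
    (fun e1 => theta_wall w1 e1 q1w) (fun e1 => theta_wall w2 (h - e1) q2w)
  <-> 0 < q1w * q2w.
Proof.
move=> w10 w20; rewrite mulf_eq0 => /norP[q10 q20] hh.
set I := [set e1 | _].
have IP x : I x <-> hstep w1 q1w < x /\ hstep w2 q2w < h - x.
  by rewrite /I /Rc /=; split=> [[/andP[]]|[]] *; repeat split; try apply/andP; try split; lra.
pose x := hstep w1 q1w + (h - hstep w1 q1w - hstep w2 q2w) / 3.
pose y := hstep w1 q1w + (h - hstep w1 q1w - hstep w2 q2w) / 2.
have Ix : I x by apply/IP; rewrite /x; lra.
have Iy : I y by apply/IP; rewrite /y; lra.
have xy : x < y by rewrite /x /y; lra.
have notboth f : ~ (increasing_on I f /\ decreasing_on I f).
  by move=> [/(_ x y Ix Iy xy) h1 /(_ x y Ix Iy xy) h2]; have := lt_trans h1 h2; rewrite ltxx.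
have i1 : 0 < q1w -> increasing_on I (fun e1 => theta_wall w1 e1 q1w).
  by move=> q0 u v /IP[hu _] /IP[hv _]; exact: theta_wall_increasing.
have d1 : q1w < 0 -> decreasing_on I (fun e1 => theta_wall w1 e1 q1w).
  by move=> q0 u v /IP[hu _] /IP[hv _]; exact: theta_wall_decreasing.
have d2 : 0 < q2w -> decreasing_on I (fun e1 => theta_wall w2 (h - e1) q2w).
  move=> q0 u v /IP[_ hu] /IP[_ hv] uv; apply: theta_wall_increasing => //; lra.
have i2 : q2w < 0 -> increasing_on I (fun e1 => theta_wall w2 (h - e1) q2w).
  move=> q0 u v /IP[_ hu] /IP[_ hv] uv; apply: theta_wall_decreasing => //; lra.
case: (ltrgtP q1w 0) q10 => // s1 _; case: (ltrgtP q2w 0) q20 => // s2 _.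
- rewrite nmulr_lgt0// s1; split=> // _; right; split; [exact: d1|exact: i2].
- rewrite pmulr_lgt0// (lt_gtF s1); split=> // -[[I1 _]|[_ I2]].
    by case: (notboth _ (conj I1 (d1 s1))).
  by case: (notboth _ (conj I2 (d2 s2))).
- rewrite nmulr_lgt0// (lt_gtF s1); split=> // -[[_ D2]|[D1 _]].
    by case: (notboth _ (conj (i2 s2) D2)).
  by case: (notboth _ (conj (i1 s1) D1)).
- by rewrite pmulr_lgt0// s1; split=> // _; left; split; [exact: i1|exact: d2].
Qed.

(** * Determinism of the step system *)

Section Determinism.
Variable R : realType.

Lemma propagator_inj (k : R) c sn (q p q' p' tau : R) : propagator k c sn ->
  qmove c sn q p tau = qmove c sn q' p' tau ->
  pmove k c sn q p tau = pmove k c sn q' p' tau -> q = q' /\ p = p'.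
Proof.
move=> cs; have n := prop_norm cs tau; rewrite /qmove /pmove => h1 h2.
have E (x y : R) : x = (x * c tau + y * sn tau) * c tau -
    (y * c tau - k * x * sn tau) * sn tau.
  by rewrite -[LHS]mulr1 -n; ring.
have E' (x y : R) : y = (y * c tau - k * x * sn tau) * c tau +
    k * (x * c tau + y * sn tau) * sn tau.
  by rewrite -[LHS]mulr1 -n; ring.
by split; [rewrite (E q p) (E q' p') h1 h2|rewrite (E' q p) (E' q' p') h1 h2].
Qed.

Lemma local_motion_right_unique (k : R) c sn T hit hit' (q p q' p' : R -> R) t :
  local_motion k c sn T hit q p -> local_motion k c sn T hit' q' p' ->
  0 <= t < T -> q t = q' t -> p t = p' t ->
  \forall s \near t^'+, q s = q' s /\ p s = p' s.
Proof.
move=> [mr _] [mr' _] tT qt pt; have := mr' t tT; have := mr t tT.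
by apply: filterS2 => s [-> ->] [-> ->]; rewrite qt pt.
Qed.

(** The backward motion determines the incoming state, the propagation being
    invertible. *)
Lemma local_motion_left_unique (k : R) c sn T hit hit' (q p q' p' : R -> R) t :
  propagator k c sn ->
  local_motion k c sn T hit q p -> local_motion k c sn T hit' q' p' ->
  0 < t <= T -> (\forall s \near t^'-, q s = q' s /\ p s = p' s) ->
  q t = q' t /\ incoming hit p t = incoming hit' p' t.
Proof.
move=> cs [_ ml] [_ ml'] tT agree.
suff /filter_ex[s [qE pE]] : \forall s \near t^'-,
    qmove c sn (q t) (incoming hit p t) (s - t) =
      qmove c sn (q' t) (incoming hit' p' t) (s - t) /\
    pmove k c sn (q t) (incoming hit p t) (s - t) =
      pmove k c sn (q' t) (incoming hit' p' t) (s - t).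
  exact: propagator_inj cs qE pE.
have := agree; have := ml' t tT; have := ml t tT.
by apply: filterS3 => s [-> ->] [-> ->].
Qed.

Lemma incoming_inj (hit hit' : set R) (p p' : R -> R) t :
  (hit t <-> hit' t) -> incoming hit p t = incoming hit' p' t -> p t = p' t.
Proof.
by move=> hh; rewrite /incoming (asbool_equiv_eq hh); case: ifP => // _ /oppr_inj.
Qed.

(** First-failure argument: at the infimum of the times of disagreement the two
    functions agree by left determinism, and then a bit beyond by right
    determinism. *)
Lemma agree_on_segment (X : Type) (T : R) (z z' : R -> X) :
  z 0 = z' 0 ->
  (forall t, 0 <= t < T -> z t = z' t -> \forall s \near t^'+, z s = z' s) ->
  (forall t, 0 < t <= T -> (forall s, 0 <= s < t -> z s = z' s) -> z t = z' t) ->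
  forall t, 0 <= t <= T -> z t = z' t.
Proof.
move=> z0 zr zl t tT; apply: contrapT => zt.
pose D := [set s | 0 <= s <= T /\ z s <> z' s].
have Dt : D t by [].
have lbD : lbound D 0 by move=> s [/andP[]].
have hD : has_inf D by split; [exists t|exists 0].
set m := inf D.
have m0 : 0 <= m by apply: lb_le_inf => //; exists t.
have mt : m <= t by apply: ge_inf => //; exists 0.
have mT : m <= T by apply: le_trans mt _; case/andP: tT.
have before s : 0 <= s < m -> z s = z' s.
  move=> /andP[s0 sm]; apply: contrapT => zs.
  have : m <= s.
    by apply: ge_inf; [exists 0|split=> //; rewrite s0 (le_trans (ltW sm))].
  by rewrite leNgt sm.
have zm : z m = z' m.
  have [<-//|mn0] := eqVneq 0 m.
  by apply: zl => //; rewrite lt_neqAle mn0 m0.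
have mltT : m < T.
  rewrite lt_neqAle mT andbT; apply/eqP => mE; apply: zt.
  have : t = m by apply/eqP; rewrite eq_le mt andbT mE; case/andP: tT.
  by move->.
have mI : 0 <= m < T by rewrite m0.
have [d d0 dP] := near_right_ex (zr m mI zm).
have : m + d <= m; last by rewrite gerDl leNgt d0.
apply: lb_le_inf; first by exists t.
move=> s [sI zs]; rewrite leNgt; apply/negP => smd; apply: zs.
have [sm|ms|->//] := ltrgtP s m; first by apply: before; rewrite sm andbT; case/andP: sI.
by apply: dP; rewrite ms.
Qed.

Variables (w1 w2 q1w q2w e1 e2 : R).
Hypotheses (w1_gt0 : 0 < w1) (w2_gt0 : 0 < w2).
Hypotheses (e1_gt : hstep w1 q1w < e1) (e2_gt : hstep w2 q2w < e2).
Let S := step_system w1 w2 q1w q2w e1 e2.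

Lemma trajectory_restrict (S' : impact_system R) T T' z :
  T' <= T -> trajectory S' T z -> trajectory S' T' z.
Proof.
move=> TT [lz cz h1 h2].
have le_ t : 0 <= t <= T' -> 0 <= t <= T by move=> /andP[-> /le_trans->].
have lt_ t : 0 <= t < T' -> 0 <= t < T by move=> /andP[-> /lt_le_trans->].
have ell f hit q p : elastic_coordinate T f hit q p -> elastic_coordinate T' f hit q p.
  move=> [cq d r l lh]; split.
  - apply: continuous_subspaceW cq => t /=; rewrite !in_itv/=; exact: le_.
  - by move=> t /andP[t0 tT]; apply: d; rewrite t0 (lt_le_trans tT).
  - by move=> t /lt_; exact: r.
  - by move=> t /andP[t0 tT]; apply: l; rewrite t0 (le_trans tT).
  - by move=> t /andP[t0 tT]; apply: lh; rewrite t0 (le_trans tT).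
split; [by move=> t /le_; exact: lz|by move=> t /lt_; exact: cz|exact: ell|exact: ell].
Qed.

(** On the left side only the incoming momenta are compared; as impacts depend on
    the position alone, equal positions give equal outgoing momenta. *)
Lemma step_trajectory_unique T z z' : trajectory S T z -> trajectory S T z' ->
  z 0 = z' 0 -> forall t, 0 <= t <= T -> z t = z' t.
Proof.
move=> /(step_trajectoryP w1_gt0 w2_gt0 e1_gt e2_gt)[_ _ h1 h2].
move=> /(step_trajectoryP w1_gt0 w2_gt0 e1_gt e2_gt)[_ _ h1' h2'] z0.
have phE (x y : phase R) : x.1.1 = y.1.1 /\ x.2.1 = y.2.1 ->
    x.1.2 = y.1.2 /\ x.2.2 = y.2.2 -> x = y.
  by case: x y => -[? ?] [? ?] [[? ?] [? ?]] /= [-> ->] [-> ->].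
apply: agree_on_segment => // t tT.
  move=> zt.
  have := local_motion_right_unique h1 h1' tT
    (congr1 (fun x => x.1.1) zt) (congr1 (fun x => x.2.1) zt).
  have := local_motion_right_unique h2 h2' tT
    (congr1 (fun x => x.1.2) zt) (congr1 (fun x => x.2.2) zt).
  by apply: filterS2 => s E1 E2; exact: phE.
move=> before.
have t0 : 0 < t by case/andP: tT.
have nb : \forall s \near t^'-, z s = z' s.
  apply: (near_leftI t0) => s; rewrite subrr => /andP[s0 st]; apply: before.
  by rewrite ltW.
have [q1E i1] := local_motion_left_unique (harmonic_propagator (lt0r_neq0 w1_gt0)) h1 h1' tT
  (filterS (fun s (E : z s = z' s) =>
     conj (congr1 (fun x => x.1.1) E) (congr1 (fun x => x.2.1) E)) nb).
have [q2E i2] := local_motion_left_unique (harmonic_propagator (lt0r_neq0 w2_gt0)) h2 h2' tT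
  (filterS (fun s (E : z s = z' s) =>
     conj (congr1 (fun x => x.1.2) E) (congr1 (fun x => x.2.2) E)) nb).
apply: phE; split=> //.
  by apply: incoming_inj i1 => /=; rewrite q1E q2E.
by apply: incoming_inj i2 => /=; rewrite q1E q2E.
Qed.

End Determinism.

(** * Trajectories in angle variables *)

Section Angles.
Variable R : realType.
Implicit Types (a x t T : R).

Lemma cos_ge_sym a x : 0 <= a <= pi -> - pi <= x <= pi ->
  (cos a <= cos x) = (- a <= x <= a).
Proof.
move=> aI xI; rewrite -(cos_norm x) leNgt ltr_cos ?in_itv//=; last first.
  by rewrite normr_ge0 ler_norml.
by rewrite -leNgt ler_norml.
Qed.

Lemma cos_gt_sym a x : 0 <= a <= pi -> - pi <= x <= pi ->
  (cos a < cos x) = (- a < x < a).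
Proof.
move=> aI xI; rewrite -(cos_norm x) ltr_cos ?in_itv//=; last first.
  by rewrite normr_ge0 ler_norml.
by rewrite ltr_norml.
Qed.

Lemma cos_2piB x : cos (2 * pi - x) = cos x.
Proof. by rewrite -cosN opprB mulr2n mulrDl mul1r -mulr2n cosB cos2pi sin2pi mulr1 mulr0 addr0. Qed.

Lemma cos_gt_turn a x : 0 <= a <= pi -> 0 <= x <= 2 * pi ->
  (cos a < cos x) = (x < a) || (2 * pi - a < x).
Proof.
move=> /andP[a0 api] /andP[x0 x2pi].
have [xpi|xpi] := leP x pi.
  rewrite cos_gt_sym ?a0//; last by rewrite xpi andbT (le_trans _ x0)// oppr_le0 pi_ge0.
  apply/andP/orP => [[_ ->]|]; first by left.
  by case; lra.
rewrite -(cos_2piB x) cos_gt_sym ?a0//; last by apply/andP; split; lra.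
apply/andP/orP => [[_ h]|]; first by right; lra.
by case; lra.
Qed.

Lemma cos_ge_turn a x : 0 <= a <= pi -> 0 <= x <= 2 * pi ->
  (cos a <= cos x) = (x <= a) || (2 * pi - a <= x).
Proof.
move=> /andP[a0 api] /andP[x0 x2pi].
have [xpi|xpi] := leP x pi.
  rewrite cos_ge_sym ?a0//; last by rewrite xpi andbT (le_trans _ x0)// oppr_le0 pi_ge0.
  apply/andP/orP => [[_ ->]|]; first by left.
  by case; lra.
rewrite -(cos_2piB x) cos_ge_sym ?a0//; last by apply/andP; split; lra.
apply/andP/orP => [[_ h]|]; first by right; lra.
by case; lra.
Qed.

(** Constant rotation with jumps phi |-> - phi at impacts: reversing the momentum is
    a reflection of the angle, which leaves the cosine unchanged. *)
Definition angle_motion (w T : R) (hit : set R) (phi : R -> R) : Prop :=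
  (forall t, 0 <= t < T -> \forall s \near t^'+, phi s = phi t + w * (s - t)) /\
  (forall t, 0 < t <= T -> \forall s \near t^'-,
     phi s = incoming hit phi t + w * (s - t)).

Lemma harmonic_of_angle (w e T : R) hit (phi : R -> R) : 0 < w ->
  angle_motion w T hit phi ->
  harmonic_motion w T hit (fun t => Num.sqrt (2 * e) / w * cos (phi t))
    (fun t => - (Num.sqrt (2 * e) * sin (phi t))).
Proof.
move=> w0 [mr ml]; have wn : w != 0 by rewrite gt_eqF.
split=> t tT.
  apply: filterS (mr t tT) => s ->; rewrite cosD sinD /qmove /pmove.
  by split; field.
apply: filterS (ml t tT) => s ->; rewrite cosD sinD /qmove /pmove /incoming.
by case: asboolP => _; rewrite ?cosN ?sinN; split; field.
Qed.

Variables (w1 w2 q1w q2w e1 e2 : R).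
Hypotheses (w1_gt0 : 0 < w1) (w2_gt0 : 0 < w2).
Hypotheses (e1_gt : hstep w1 q1w < e1) (e2_gt : hstep w2 q2w < e2).
Let S := step_system w1 w2 q1w q2w e1 e2.
Let a := theta_wall w1 e1 q1w.
Let b := theta_wall w2 e2 q2w.

Let A1 := Num.sqrt (2 * e1) / w1.
Let A2 := Num.sqrt (2 * e2) / w2.
Let A1_gt0 : 0 < A1.
Proof. by rewrite divr_gt0// sqrtr_gt0 mulr_gt0// (energy_gt0 e1_gt). Qed.
Let A2_gt0 : 0 < A2.
Proof. by rewrite divr_gt0// sqrtr_gt0 mulr_gt0// (energy_gt0 e2_gt). Qed.

Definition angle_phase (phi1 phi2 : R) : phase R :=
  ((Num.sqrt (2 * e1) / w1 * cos phi1, Num.sqrt (2 * e2) / w2 * cos phi2),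
   (- (Num.sqrt (2 * e1) * sin phi1), - (Num.sqrt (2 * e2) * sin phi2))).

Lemma oscillatorH_angle (w e phi : R) : 0 < w -> 0 < e ->
  oscillatorH w (Num.sqrt (2 * e) / w * cos phi) (- (Num.sqrt (2 * e) * sin phi)) = e.
Proof.
move=> w0 e0; have := unfold_H (w := w) w0 e0 phi (or_introl (erefl w)).
by rewrite /unfold_q /unfold_p divff ?gt_eqF// mulr1.
Qed.

Definition angle_hit1 (phi1 phi2 : R -> R) : set R :=
  [set t | cos (phi1 t) = cos a /\ cos (phi2 t) <= cos b].
Definition angle_hit2 (phi1 phi2 : R -> R) : set R :=
  [set t | cos (phi1 t) <= cos a /\ cos (phi2 t) = cos b].

Lemma angle_trajectory T (phi1 phi2 : R -> R) :
  (forall t, 0 <= t <= T -> cos a <= cos (phi1 t) \/ cos b <= cos (phi2 t)) ->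
  (forall t, 0 <= t < T -> ~ (cos (phi1 t) = cos a /\ cos (phi2 t) = cos b)) ->
  angle_motion w1 T (angle_hit1 phi1 phi2) phi1 ->
  angle_motion w2 T (angle_hit2 phi1 phi2) phi2 ->
  trajectory S T (fun t => angle_phase (phi1 t) (phi2 t)).
Proof.
move=> lz cz h1 h2.
have q1E := qwallE w1_gt0 e1_gt; have q2E := qwallE w2_gt0 e2_gt.
rewrite -/a -/A1 in q1E; rewrite -/b -/A2 in q2E.
have A1I := mulfI (lt0r_neq0 A1_gt0); have A2I := mulfI (lt0r_neq0 A2_gt0).
have H1 : angle_hit1 phi1 phi2 =
    [set t | side1 S (angle_phase (phi1 t) (phi2 t)).1].
  apply/seteqP; split=> t; rewrite /angle_hit1 /= -/A1 -/A2 q1E q2E ler_pM2l//.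
    by move=> [-> ->].
  by move=> [/A1I -> ->].
have H2 : angle_hit2 phi1 phi2 =
    [set t | side2 S (angle_phase (phi1 t) (phi2 t)).1].
  apply/seteqP; split=> t; rewrite /angle_hit2 /= -/A1 -/A2 q1E q2E ler_pM2l//.
    by move=> [-> ->].
  by move=> [-> /A2I ->].
apply/(step_trajectoryP w1_gt0 w2_gt0 e1_gt e2_gt); split.
- move=> t /lz c; split; last 2 first.
  + by apply: oscillatorH_angle => //; exact: energy_gt0 e1_gt.
  + by apply: oscillatorH_angle => //; exact: energy_gt0 e2_gt.
  by apply/not_step; rewrite /= -/A1 -/A2 q1E q2E !ler_pM2l.
- move=> t /cz c; rewrite /= -/A1 -/A2 q1E q2E => -[/A1I x1 /A2I x2].
  exact: c.
- by rewrite -H1; exact: harmonic_of_angle.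
- by rewrite -H2; exact: harmonic_of_angle.
Qed.

End Angles.

(** * Returns to the section *)

Section FloorNear.
Variable R : realType.
Variables (c k : R).
Hypothesis c_gt0 : 0 < c.
Let G (t : R) : R := c * t + k.

Lemma floor_near_right t : \forall s \near t^'+, Num.floor (G s) = Num.floor (G t).
Proof.
have /andP[h1 h2] := floor_itv (G t); set n := Num.floor (G t) in h1 h2 *.
apply: (near_rightI (d := ((n + 1)%:~R - G t) / c)).
  by rewrite divr_gt0// subr_gt0.
move=> s /andP[ts]; rewrite -ltrBlDl ltr_pdivlMr// => st.
have cts : c * t < c * s by rewrite ltr_pM2l.
by apply: floor_def; rewrite /G in h1 h2 st *; apply/andP; split; lra.
Qed.

Lemma floor_near_left t : (Num.floor (G t))%:~R != G t ->
  \forall s \near t^'-, Num.floor (G s) = Num.floor (G t).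
Proof.
have /andP[h1 h2] := floor_itv (G t); set n := Num.floor (G t) in h1 h2 *.
move=> nint; have {nint}h1 : n%:~R < G t by rewrite lt_neqAle nint.
apply: (near_leftI (d := (G t - n%:~R) / c)).
  by rewrite divr_gt0// subr_gt0.
move=> s /andP[+ st]; rewrite ltrBlDr -ltrBlDl ltr_pdivlMr// => ts.
have cst : c * s < c * t by rewrite ltr_pM2l.
by apply: floor_def; rewrite /G in h1 h2 ts *; apply/andP; split; lra.
Qed.

Lemma floor_near_left_int t : (Num.floor (G t))%:~R = G t ->
  \forall s \near t^'-, (Num.floor (G s))%:~R = G t - 1 :> R.
Proof.
move=> h; set n := Num.floor (G t) in h *.
apply: (near_leftI (d := 1 / c)); first by rewrite divr_gt0.
move=> s /andP[+ st]; rewrite ltrBlDr -ltrBlDl ltr_pdivlMr// => ts.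
have cst : c * s < c * t by rewrite ltr_pM2l.
rewrite (@floor_def _ _ (n - 1)) ?subrK; first by rewrite intrD h.
by rewrite intrD h; rewrite /G in ts *; apply/andP; split; lra.
Qed.

End FloorNear.

Section Return.
Variable R : realType.
Variables (w1 w2 q1w q2w e1 e2 : R).
Hypotheses (w1_gt0 : 0 < w1) (w2_gt0 : 0 < w2).
Hypotheses (e1_gt : hstep w1 q1w < e1) (e2_gt : hstep w2 q2w < e2).
Let S := step_system w1 w2 q1w q2w e1 e2.
Let a := theta_wall w1 e1 q1w.
Let b := theta_wall w2 e2 q2w.
Let P := angle_phase w1 w2 e1 e2.
Let t1 := a / w1.
Let t3 := (2 * pi - a) / w1.
Variable y : R.

Let a_gt0 : 0 < a. Proof. by have /andP[] := theta_wall_itv e1_gt. Qed.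
Let a_ltpi : a < pi. Proof. by have /andP[] := theta_wall_itv e1_gt. Qed.
Let b_gt0 : 0 < b. Proof. by have /andP[] := theta_wall_itv e2_gt. Qed.
Let b_ltpi : b < pi. Proof. by have /andP[] := theta_wall_itv e2_gt. Qed.
Let aI : 0 <= a <= pi. Proof. by rewrite !ltW. Qed.
Let bI : 0 <= b <= pi. Proof. by rewrite !ltW. Qed.
Let w1t1 : w1 * t1 = a. Proof. by rewrite /t1; field; rewrite gt_eqF. Qed.
Let w1t3 : w1 * t3 = 2 * pi - a. Proof. by rewrite /t3; field; rewrite gt_eqF. Qed.
Let lt_t1 t : (t < t1) = (w1 * t < a). Proof. by rewrite -w1t1 ltr_pM2l. Qed.
Let t1_gt0 : 0 < t1. Proof. by rewrite divr_gt0. Qed.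
Let lt13 : t1 < t3. Proof. by have ap := a_ltpi; rewrite -(ltr_pM2l w1_gt0) w1t1 w1t3; lra. Qed.

Lemma Sigma1_angle (phi1 phi2 : R) :
  Sigma1 w1 (P phi1 phi2) <-> sin phi1 = 0 /\ 0 < cos phi1.
Proof.
have e10 := energy_gt0 e1_gt.
have E0 : 0 < Num.sqrt (2 * e1) by rewrite sqrtr_gt0 mulr_gt0.
rewrite /Sigma1 /= oscillator_force oppr_lt0 pmulr_rgt0 ?exprn_gt0//.
rewrite pmulr_rgt0 ?divr_gt0//; split=> -[h1 h2]; split=> //.
  by move/eqP: h1; rewrite oppr_eq0 mulf_eq0 gt_eqF//= => /eqP.
by rewrite h1 mulr0 oppr0.
Qed.

Lemma not_Sigma1_turn (x phi2 : R) : 0 < x < 2 * pi -> ~ Sigma1 w1 (P x phi2).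
Proof.
move=> /andP[x0 x2] /Sigma1_angle[s0 c0].
have [xpi|pix|xpi] := ltrgtP x pi.
- by have := sin_gt0_pi (x := x); rewrite x0 xpi s0 ltxx => /(_ erefl).
- have : 0 < sin (x - pi) by apply: sin_gt0_pi; apply/andP; split; lra.
  by rewrite sinB cospi sinpi s0 mul0r mulr0 subr0 ltxx.
- by move: c0; rewrite xpi cospi ltrNr oppr0 ltr10.
Qed.

Lemma cos_w1t_ge t : 0 <= t <= 2 * pi / w1 ->
  (cos a <= cos (w1 * t)) = (t <= t1) || (t3 <= t).
Proof.
move=> /andP[t0 tT]; rewrite cos_ge_turn//.
  by rewrite -w1t3 -[in X in X || _]w1t1 !ler_pM2l.
by rewrite mulr_ge0 ?(ltW w1_gt0)//= mulrC -ler_pdivlMr.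
Qed.

Lemma cos_w1t_le t : 0 <= t <= 2 * pi / w1 ->
  (cos (w1 * t) <= cos a) = (t1 <= t <= t3).
Proof.
move=> /andP[t0 tT]; rewrite leNgt cos_gt_turn//.
  by rewrite -w1t3 -[in X in X || _]w1t1 !ltr_pM2l// negb_or -!leNgt.
by rewrite mulr_ge0 ?(ltW w1_gt0)//= mulrC -ler_pdivlMr.
Qed.

Lemma cos_w1t_eq t : 0 <= t <= 2 * pi / w1 -> cos (w1 * t) = cos a ->
  t = t1 \/ t = t3.
Proof.
move=> tI cE; have := cos_w1t_ge tI; have := cos_w1t_le tI.
rewrite cE lexx => /esym/andP[h1 h2] /esym/orP[h3|h3].
  by left; apply/eqP; rewrite eq_le h1 h3.
by right; apply/eqP; rewrite eq_le h2 h3.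
Qed.

Lemma angle_motion_free (w T phi0 : R) (hit : set R) :
  (forall t, 0 < t <= T -> ~ hit t) ->
  angle_motion w T hit (fun t => phi0 + w * t).
Proof.
move=> nh; split=> t tT.
  by apply: nearW => s; ring.
apply: nearW => s; rewrite /incoming; case: asboolP => [/(nh _ tT)//|_]; ring.
Qed.

(** The angle from which the second oscillator reaches [y] at the time [t1] when
    the first one reaches its wall. *)
Let y0 := y - w2 * t1.

Section Reflected.
Hypothesis yI : b < y < 2 * pi - b.

Let cos_y : cos y < cos b.
Proof.
have b0 := b_gt0; case/andP: yI => h1 h2; rewrite ltNge cos_ge_turn//;
  last by apply/andP; split; lra.
by rewrite negb_or -!ltNge h1.
Qed.

(** The impact at [t1] reflects the angle [a] to [- a]. *)
Definition reflected_angle1 t : R := if t < t1 then w1 * t else w1 * t - 2 * a.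

Lemma reflected_angle1_itv t : 0 <= t <= 2 * t1 -> - a <= reflected_angle1 t <= a.
Proof.
move=> /andP[]; rewrite /reflected_angle1 -[0 <= t](ler_pM2l w1_gt0) -[t <= _](ler_pM2l w1_gt0).
rewrite mulr0 mulrCA w1t1 => t0 tT; have a0 := a_gt0.
by rewrite lt_t1; case: ltP => h; apply/andP; split; lra.
Qed.

Lemma reflected_angle1_wall t : 0 <= t <= 2 * t1 -> cos (reflected_angle1 t) <= cos a -> t = t1.
Proof.
move=> tI; rewrite leNgt cos_gt_sym//; last first.
  by have ap := a_ltpi; have /andP[h1 h2] := reflected_angle1_itv tI; apply/andP; split; lra.
move=> /negP h; apply/eqP; apply: contra_notT h => tne.
have a0 := a_gt0; case/andP: tI.
rewrite -[0 <= t](ler_pM2l w1_gt0) -[t <= _](ler_pM2l w1_gt0) mulr0 mulrCA w1t1 => h1 h2.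
rewrite /reflected_angle1; have [lt|gt|/eqP] := ltrgtP t t1; last by rewrite (negbTE tne).
  by move: lt; rewrite -(ltr_pM2l w1_gt0) w1t1 => lt; apply/andP; split; lra.
by move: gt; rewrite -(ltr_pM2l w1_gt0) w1t1 => gt; apply/andP; split; lra.
Qed.

Lemma trajectory_reflected : trajectory S (2 * t1) (fun t => P (reflected_angle1 t) (y0 + w2 * t)).
Proof.
have at_t1 : y0 + w2 * t1 = y by rewrite /y0 subrK.
apply: angle_trajectory => //.
- move=> t tI; left; rewrite cos_ge_sym//; first exact: reflected_angle1_itv.
  by have ap := a_ltpi; have /andP[h1 h2] := reflected_angle1_itv tI; apply/andP; split; lra.
- move=> t /andP[t0 tT] [c1 c2].
  have tE : t = t1 by apply: reflected_angle1_wall; rewrite ?t0 ?(ltW tT)// c1.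
  by move: c2 cos_y; rewrite tE at_t1 => ->; rewrite ltxx.
- split=> t /andP[t0 tT].
    have [tt|tt] := ltP t t1.
      apply: (near_rightI (d := t1 - t)); first by rewrite subr_gt0.
      move=> s /andP[ts]; rewrite subrKC => st.
      by rewrite /reflected_angle1 tt st; ring.
    apply: (near_rightI ltr01) => s /andP[ts _].
    by rewrite /reflected_angle1 !ltNge tt (le_trans tt (ltW ts))/=; ring.
  have [tt|tt|tt] := ltrgtP t t1.
  + apply: (near_leftI t0) => s /andP[_ st].
    rewrite /incoming asboolF; first by rewrite /reflected_angle1 tt (lt_trans st tt); ring.
    move=> [c1 _]; have tE : t = t1 by apply: reflected_angle1_wall; rewrite ?c1 ?(ltW t0).
    by move: tt; rewrite tE ltxx.
  + apply: (near_leftI (d := t - t1)); first by rewrite subr_gt0.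
    move=> s /andP[+ st]; rewrite subKr => ts.
    rewrite /incoming asboolF; first by rewrite /reflected_angle1 !ltNge !ltW//=; ring.
    move=> [c1 _]; have tE : t = t1 by apply: reflected_angle1_wall; rewrite ?c1 ?(ltW t0).
    by move: tt; rewrite tE ltxx.
  + apply: (near_leftI t0) => s /andP[_ st].
    have pE : reflected_angle1 t = - a by rewrite /reflected_angle1 tt ltxx w1t1; ring.
    rewrite /incoming asboolT; last first.
      by split; [rewrite pE cosN|rewrite tt at_t1 ltW].
    by rewrite pE opprK /reflected_angle1 -tt st -w1t1 tt; ring.
- apply: angle_motion_free => t /andP[t0 tT] [c1 c2].
  have tE : t = t1 by apply: reflected_angle1_wall; rewrite ?c1 ?(ltW t0).
  by move: c2 cos_y; rewrite tE at_t1 => ->; rewrite ltxx.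
Qed.

Lemma first_return_reflected : first_return S (Sigma1 w1) (P 0 y0) (P 0 (y + w2 * t1)).
Proof.
exists (2 * t1), (fun t => P (reflected_angle1 t) (y0 + w2 * t)); split.
- by rewrite mulr_gt0.
- exact: trajectory_reflected.
- split; first by rewrite /reflected_angle1 t1_gt0 mulr0 mulr0 addr0.
  by apply/Sigma1_angle; rewrite sin0 cos0.
- split; last by apply/Sigma1_angle; rewrite sin0 cos0.
  have -> : reflected_angle1 (2 * t1) = 0.
    rewrite /reflected_angle1 ltNge (_ : t1 <= 2 * t1) /=; first by rewrite -w1t1; ring.
    by have := t1_gt0; lra.
  by congr P; rewrite /y0; ring.
- have a0 := a_gt0; have ap := a_ltpi.
  move=> t /andP[]; rewrite -[0 < t](ltr_pM2l w1_gt0) -[t < _](ltr_pM2l w1_gt0).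
  rewrite mulr0 mulrCA w1t1 /reflected_angle1 => t0 tT.
  rewrite lt_t1; case: ltP => tt.
    by apply: not_Sigma1_turn; apply/andP; split; lra.
  move=> /Sigma1_angle[s0 _].
  have : 0 < sin (- (w1 * t - 2 * a)) by apply: sin_gt0_pi; apply/andP; split; lra.
  by rewrite sinN s0 oppr0 ltxx.
Qed.

End Reflected.

Section Entered.
Hypothesis yI : - b < y < b.

Let c := w2 / (2 * b).
Let k := (y + b - w2 * t1) / (2 * b).
Let b2_gt0 : 0 < 2 * b. Proof. by rewrite mulr_gt0. Qed.
Let c_gt0 : 0 < c. Proof. by rewrite divr_gt0. Qed.
Let gE t : 2 * b * (c * t + k) = y + b + w2 * (t - t1).
Proof. by rewrite /c /k; field; rewrite gt_eqF. Qed.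

Let floor_t1 : Num.floor (c * t1 + k) = 0.
Proof.
case/andP: yI => h1 h2; apply: floor_def; rewrite add0r.
have b0 := b2_gt0; have E := gE t1; rewrite subrr mulr0 addr0 in E.
by rewrite -(ler_pM2l b0) -(ltr_pM2l b0) E; apply/andP; split; lra.
Qed.

(** Impacts on the second wall occur only while the first oscillator is beyond
    its own, in ]t1, t3[, each time the freely turning angle y + w2 (t - t1)
    passes [b] modulo 2 b; the count is frozen outside that interval. *)
Definition impacts t : int :=
  if t < t1 then 0 else if t < t3 then Num.floor (c * t + k) else Num.floor (c * t3 + k).

Definition arm_angle2 t : R := y0 + w2 * t - 2 * b * (impacts t)%:~R.

Lemma impacts_before t : t <= t1 -> impacts t = 0.
Proof.
rewrite /impacts le_eqVlt => /predU1P[->|->//].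
by rewrite ltxx lt13 floor_t1.
Qed.

Lemma impacts_inside t : t1 <= t <= t3 -> impacts t = Num.floor (c * t + k).
Proof.
rewrite /impacts => /andP[h1 h2]; rewrite ltNge h1/=.
by case: ltP => // h3; have -> : t = t3 by apply/eqP; rewrite eq_le h2.
Qed.

Lemma impacts_after t : t3 <= t -> impacts t = Num.floor (c * t3 + k).
Proof.
by rewrite /impacts => h; rewrite !ltNge h (le_trans (ltW lt13) h).
Qed.

Lemma arm_angle2_inside t : t1 <= t <= t3 ->
  arm_angle2 t = - b + 2 * b * (c * t + k - (Num.floor (c * t + k))%:~R).
Proof.
by move=> tI; rewrite /arm_angle2 (impacts_inside tI) mulrBr gE /y0; ring.
Qed.

Lemma arm_angle2_itv t : t1 <= t <= t3 -> - b <= arm_angle2 t < b.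
Proof.
move=> tI; rewrite (arm_angle2_inside tI); have /andP[h1 h2] := floor_itv (c * t + k).
rewrite intrD in h2; have b0 := b2_gt0.
set x := c * t + k - _; have x0 : 0 <= x by rewrite subr_ge0.
have x1 : x < 1 by rewrite ltrBlDl.
have : 2 * b * x < 2 * b * 1 by rewrite ltr_pM2l.
have : 0 <= 2 * b * x by rewrite mulr_ge0// ltW.
by move=> h3 h4; apply/andP; split; lra.
Qed.

Lemma arm_angle2_wall t : t1 <= t <= t3 ->
  arm_angle2 t = - b <-> (Num.floor (c * t + k))%:~R = c * t + k.
Proof.
move=> tI; rewrite (arm_angle2_inside tI); split=> [|->]; last by rewrite subrr mulr0 addr0.
move=> /eqP; rewrite -subr_eq0 addrC addKr mulf_eq0 (gt_eqF b2_gt0)/= subr_eq0.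
by move=> /eqP.
Qed.

Lemma cos_arm_angle2 t : t1 <= t <= t3 -> cos b <= cos (arm_angle2 t).
Proof.
have bp := b_ltpi; have b0 := b_gt0.
move=> /arm_angle2_itv/andP[h1 h2]; rewrite cos_ge_sym//; last by apply/andP; split; lra.
by rewrite h1 ltW.
Qed.

Lemma cos_arm_angle2_eq t : t1 <= t <= t3 -> cos (arm_angle2 t) = cos b ->
  (Num.floor (c * t + k))%:~R = c * t + k.
Proof.
have bp := b_ltpi; have b0 := b_gt0.
move=> tI cE; apply/(arm_angle2_wall tI); have /andP[h1 h2] := arm_angle2_itv tI.
apply/eqP; rewrite eq_le h1 andbT leNgt; apply/negP => h3.
have : cos b < cos (arm_angle2 t).
  by rewrite cos_gt_sym// ?h3 ?h2//; apply/andP; split; lra.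
by rewrite cE ltxx.
Qed.

Let t1_not_wall : (Num.floor (c * t1 + k))%:~R != c * t1 + k.
Proof.
rewrite floor_t1; apply/eqP => E; have := gE t1; rewrite -E mulr0 subrr mulr0 addr0.
by case/andP: yI => h1 h2; lra.
Qed.

(** The point leaves the arm through the corner when the laps made on the circle
    of length 2 b are then an integer in number; the disjunction says that the
    exit time [t3] is not reached or that this does not happen. *)
Lemma trajectory_through_arm T : T <= 2 * pi / w1 ->
  T < t3 \/ (Num.floor (c * t3 + k))%:~R != c * t3 + k ->
  trajectory S T (fun t => P (w1 * t) (arm_angle2 t)).
Proof.
move=> TP nc.
have tI t : 0 <= t <= T -> 0 <= t <= 2 * pi / w1.
  by move=> /andP[-> /le_trans->].
have walls t : 0 <= t <= T -> t = t1 \/ t = t3 ->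
    cos b < cos (arm_angle2 t).
  move=> /andP[t0 tT] tw.
  have ti : t1 <= t <= t3 by case: tw => ->; rewrite lexx ltW.
  rewrite lt_neqAle cos_arm_angle2// andbT; apply/eqP => /esym/(cos_arm_angle2_eq ti) E.
  case: tw => tE; first by move: t1_not_wall; rewrite -tE E eqxx.
  by case: nc => [|]; [rewrite ltNge -tE tT|rewrite -tE E eqxx].
apply: angle_trajectory => //.
- move=> t /tI tP; rewrite (cos_w1t_ge tP).
  have [h1|h1] := leP t t1; first by left.
  have [h2|h2] := leP t3 t; first by left; rewrite orbT.
  by right; apply: cos_arm_angle2; rewrite !ltW.
- move=> t /andP[t0 tT] [c1 c2].
  have tTI : 0 <= t <= T by rewrite t0 ltW.
  by have := walls t tTI (cos_w1t_eq (tI _ tTI) c1); rewrite c2 ltxx.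
- have := @angle_motion_free w1 T 0 (angle_hit1 w1 w2 q1w q2w e1 e2 ( *%R w1) arm_angle2).
  rewrite (_ : (fun t => 0 + w1 * t) = *%R w1); last by apply/funext => t; rewrite add0r.
  apply => t /andP[t0 tT] [/= c1 c2].
  have tTI : 0 <= t <= T by rewrite tT ltW.
  by have := walls t tTI (cos_w1t_eq (tI _ tTI) c1); rewrite ltNge c2.
have nohit t : 0 <= t <= T -> t <= t1 \/ t3 < t \/
    (t1 <= t <= t3 /\ (Num.floor (c * t + k))%:~R != c * t + k) ->
    ~ angle_hit2 w1 w2 q1w q2w e1 e2 (fun t => w1 * t) arm_angle2 t.
  move=> tT H [/=]; rewrite (cos_w1t_le (tI _ tT)) => ti /(cos_arm_angle2_eq ti) E.
  case: H => [h|[h|[_]]]; last by rewrite E eqxx.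
    have tE : t = t1 by apply/eqP; rewrite eq_le h; case/andP: ti.
    by move: t1_not_wall; rewrite -tE E eqxx.
  by case/andP: ti => _; rewrite leNgt h.
have same t s : impacts s = impacts t -> arm_angle2 s = arm_angle2 t + w2 * (s - t).
  by rewrite /arm_angle2 => ->; ring.
split=> t /andP[t0 tT].
  have [h1|h1] := ltP t t1.
    apply: (near_rightI (d := t1 - t)); first by rewrite subr_gt0.
    move=> s /andP[ts]; rewrite subrKC => st; apply: same.
    by rewrite !impacts_before ?ltW.
  have [h2|h2] := ltP t t3; last first.
    apply: (near_rightI ltr01) => s /andP[ts _]; apply: same.
    by rewrite !impacts_after ?(le_trans h2 (ltW ts)).
  have nr : \forall s \near t^'+, t < s < t3.
    apply: (near_rightI (d := t3 - t)); first by rewrite subr_gt0.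
    by move=> s; rewrite subrKC.
  have := floor_near_right k c_gt0 t; move: nr; apply: filterS2 => s /andP[ts st] E.
  apply: same; rewrite !impacts_inside ?E// ?h1 ?(ltW h2)//.
  by rewrite (le_trans h1 (ltW ts)) ltW.
have tTI : 0 <= t <= T by rewrite tT ltW.
have [h1|h1] := leP t t1.
  apply: (near_leftI t0) => s /andP[_ st].
  rewrite /incoming asboolF; last by apply: nohit => //; left.
  by apply: same; rewrite !impacts_before// (le_trans (ltW st)).
have [h2|h2] := ltP t3 t.
  apply: (near_leftI (d := t - t3)); first by rewrite subr_gt0.
  move=> s /andP[+ st]; rewrite subKr => ts.
  rewrite /incoming asboolF; last by apply: nohit => //; right; left.
  by apply: same; rewrite !impacts_after// ltW.
have ti : t1 <= t <= t3 by rewrite (ltW h1).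
have nl : \forall s \near t^'-, t1 < s < t.
  apply: (near_leftI (d := t - t1)); first by rewrite subr_gt0.
  by move=> s; rewrite subKr.
have si s : t1 < s < t -> t1 <= s <= t3.
  by move=> /andP[hs1 hs2]; rewrite (ltW hs1) (le_trans (ltW hs2)).
have [E|nE] := eqVneq (Num.floor (c * t + k))%:~R (c * t + k); last first.
  rewrite /incoming asboolF; last by apply: nohit => //; right; right.
  have := floor_near_left c_gt0 nE; move: nl; apply: filterS2 => s sI fE.
  by apply: same; rewrite !impacts_inside// si.
have pE : arm_angle2 t = - b by apply/(arm_angle2_wall ti).
rewrite /incoming asboolT; last first.
  by split; rewrite ?(cos_w1t_le (tI _ tTI))// pE cosN.
have := floor_near_left_int c_gt0 E; move: nl; apply: filterS2 => s sI fE.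
rewrite pE /arm_angle2 (impacts_inside (si _ sI)) fE mulrBr gE /y0; ring.
Qed.

Let t3_lt : t3 < 2 * pi / w1.
Proof.
by have a0 := a_gt0; rewrite ltr_pdivlMr// mulrC w1t3; lra.
Qed.

Lemma angle_phase_2pi phi : P (2 * pi) phi = P 0 phi.
Proof.
rewrite /P /angle_phase (_ : 2 * pi = pi *+ 2); last by rewrite mulr_natl.
by rewrite cos2pi sin2pi cos0 sin0.
Qed.

Lemma first_return_through_arm : (Num.floor (c * t3 + k))%:~R != c * t3 + k ->
  first_return S (Sigma1 w1) (P 0 y0)
    (P 0 (y0 + w2 * (2 * pi / w1) - 2 * b * (Num.floor (c * t3 + k))%:~R)).
Proof.
move=> nc; exists (2 * pi / w1), (fun t => P (w1 * t) (arm_angle2 t)); split.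
- by rewrite divr_gt0// mulr_gt0// pi_gt0.
- by apply: trajectory_through_arm => //; right.
- split; last by apply/Sigma1_angle; rewrite sin0 cos0.
  by rewrite /arm_angle2 impacts_before ?(ltW t1_gt0)// !mulr0 subr0 addr0.
- have -> : w1 * (2 * pi / w1) = 2 * pi by field; rewrite gt_eqF.
  rewrite angle_phase_2pi /arm_angle2 impacts_after ?(ltW t3_lt)//; split=> //.
  by apply/Sigma1_angle; rewrite sin0 cos0.
- move=> t /andP[t0 tT]; apply: not_Sigma1_turn.
  by rewrite mulr_gt0//= mulrC -ltr_pdivlMr.
Qed.

End Entered.

(** A trajectory from the same point agrees with the given one before [T0], hence
    reaches the corner at [T0] by continuity.  It cannot go on, and the corner is
    not on the section, being reached with non-zero first momentum. *)
Lemma no_return_at_corner (T0 psi1 psi2 : R) (phi1 phi2 : R -> R) (z' : phase R) :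
  0 < T0 ->
  (forall T, T < T0 -> trajectory S T (fun t => P (phi1 t) (phi2 t))) ->
  (\forall s \near T0^'-, phi1 s = psi1 + w1 * (s - T0)) ->
  (\forall s \near T0^'-, phi2 s = psi2 + w2 * (s - T0)) ->
  cos psi1 = cos a -> cos psi2 = cos b ->
  (forall t, 0 < t < T0 -> ~ Sigma1 w1 (P (phi1 t) (phi2 t))) ->
  ~ first_return S (Sigma1 w1) (P (phi1 0) (phi2 0)) z'.
Proof.
move=> T00 tr n1 n2 c1 c2 nS [T [z [Tpos tz [z0 _] [zT ST] _]]].
have [TT|TT] := ltP T T0.
  have := step_trajectory_unique w1_gt0 w2_gt0 e1_gt e2_gt tz (tr T TT) z0.
  move=> /(_ T); rewrite lexx ltW// => /(_ erefl) zE.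
  by apply: (nS T); rewrite ?Tpos// -zE zT.
have agree t : 0 <= t < T0 -> z t = P (phi1 t) (phi2 t).
  move=> /andP[t0 tT].
  have tz' : trajectory S t z by apply: trajectory_restrict tz; rewrite (le_trans (ltW tT)).
  apply: (step_trajectory_unique w1_gt0 w2_gt0 e1_gt e2_gt tz' (tr t tT) z0).
  by rewrite t0 lexx.
have near_agree : \forall s \near T0^'-, z s = P (phi1 s) (phi2 s).
  apply: (near_leftI T00) => s; rewrite subrr => /andP[s0 sT]; apply: agree.
  by rewrite ltW.
have limE (w e qw psi : R) (q phi : R -> R) : 0 < w -> hstep w qw < e ->
    (\forall s \near T0^'-, phi s = psi + w * (s - T0)) ->
    (\forall s \near T0^'-, q s = Num.sqrt (2 * e) / w * cos (phi s)) ->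
    q s @[s --> T0^'-] --> q T0 -> cos psi = cos (theta_wall w e qw) -> q T0 = qw.
  move=> w0 he np nq ql cE.
  rewrite [RHS](qwallE w0 he) -cE; rewrite -(cvg_lim (@Rhausdorff R) ql); apply: cvg_lim => //.
  have cc : Num.sqrt (2 * e) / w * cos (psi + w * (s - T0)) @[s --> T0] -->
      Num.sqrt (2 * e) / w * cos psi.
    apply: cvgM; first exact: cvg_cst.
    apply: continuous_cvg; first exact: continuous_cos.
    rewrite -[X in _ --> X]addr0 -[X in psi + X](mulr0 w) -[X in w * X](subrr T0).
    apply: cvgD; first exact: cvg_cst.
    apply: cvgM; first exact: cvg_cst.
    by apply: cvgB; [exact: cvg_id|exact: cvg_cst].
  apply: cvg_trans (cvg_at_left_filter cc).
  by apply: near_eq_cvg; move: np nq; apply: filterS2 => s pE ->; rewrite pE.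
have [_ cz [cq1 _ _ _ _] [cq2 _ _ _ _]] := tz.
have q1l := ((within_segmentP _ Tpos).1 cq1).2 T0; rewrite T00 TT in q1l.
have q2l := ((within_segmentP _ Tpos).1 cq2).2 T0; rewrite T00 TT in q2l.
have q1E : (z T0).1.1 = q1w.
  apply: (limE _ _ _ _ (fun s => (z s).1.1) _ w1_gt0 e1_gt n1 _ (q1l erefl) c1).
  by apply: filterS near_agree => s ->.
have q2E : (z T0).1.2 = q2w.
  apply: (limE _ _ _ _ (fun s => (z s).1.2) _ w2_gt0 e2_gt n2 _ (q2l erefl) c2).
  by apply: filterS near_agree => s ->.
move: TT; rewrite le_eqVlt => /predU1P[TE|TT].
  have [lz _ _ _] := tz.
  have [|_ H1 _] := lz T0; first by rewrite -TE (ltW T00) lexx.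
  have [m m0 mP] := wall_speed e1_gt.
  move: ST; rewrite -zT -TE => -[p0 _].
  by move: H1; rewrite q1E p0 => /mP; rewrite normr0 leNgt m0.
apply: (cz T0); first by rewrite (ltW T00).
by rewrite [LHS]surjective_pairing q1E q2E.
Qed.

Lemma no_return_entry (z' : phase R) : y = b \/ y = - b ->
  ~ first_return S (Sigma1 w1) (P 0 y0) z'.
Proof.
move=> yE.
have t1P : t1 <= 2 * pi / w1.
  by have a0 := a_gt0; have ap := a_ltpi; rewrite ler_pdivlMr// mulrC w1t1; lra.
have := @no_return_at_corner t1 a y (fun t => 0 + w1 * t) (fun t => y0 + w2 * t) z' t1_gt0.
rewrite !mulr0 !addr0; apply.
- move=> T TT.
  have before t : 0 <= t <= T -> cos a < cos (w1 * t).
    move=> /andP[t0 tT]; have tt1 := le_lt_trans tT TT.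
    have tI : 0 <= t <= 2 * pi / w1 by rewrite t0 (le_trans (ltW tt1)).
    by rewrite ltNge (cos_w1t_le tI) negb_and -ltNge tt1.
  have before' t : 0 < t <= T -> cos a < cos (w1 * t).
    by move=> /andP[t0 tT]; apply: before; rewrite ltW.
  apply: angle_trajectory => //.
  + by move=> t tI; left; rewrite add0r ltW// before.
  + move=> t /andP[t0 tT]; rewrite add0r => -[cE _].
    by have := before t; rewrite t0 (ltW tT) cE ltxx => /(_ erefl).
  + by apply: angle_motion_free => t /before'; rewrite /angle_hit1 /= add0r =>
    + [cE _]; rewrite cE ltxx.
  + by apply: angle_motion_free => t /before'; rewrite /angle_hit2 /= add0r =>
    + [cE _]; rewrite ltNge cE.
- by apply: nearW => s; rewrite -w1t1; ring.
- by apply: nearW => s; rewrite /y0; ring.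
- by [].
- by case: yE => ->; rewrite ?cosN.
- move=> t /andP[t0 tt]; rewrite add0r; apply: not_Sigma1_turn.
  by rewrite mulr_gt0//= mulrC -ltr_pdivlMr// (lt_le_trans tt).
Qed.

Lemma no_return_exit (z' : phase R) : - b < y < b ->
  let x := w2 / (2 * b) * t3 + (y + b - w2 * t1) / (2 * b) in
  (Num.floor x)%:~R = x ->
  ~ first_return S (Sigma1 w1) (P 0 y0) z'.
Proof.
move=> yI x xE.
have t3P : t3 < 2 * pi / w1.
  by have a0 := a_gt0; rewrite ltr_pdivlMr// mulrC w1t3; lra.
have := @no_return_at_corner t3 (2 * pi - a) b (fun t => 0 + w1 * t) arm_angle2 z'
  (lt_trans t1_gt0 lt13).
have k0 : arm_angle2 0 = y0.
  by rewrite /arm_angle2 impacts_before ?(ltW t1_gt0)// !mulr0 subr0 addr0.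
rewrite k0 mulr0 addr0; apply.
- move=> T TT; have -> : (fun t => P (0 + w1 * t) (arm_angle2 t)) =
      (fun t => P (w1 * t) (arm_angle2 t)).
    by apply/funext => t; rewrite add0r.
  by apply: trajectory_through_arm => //; [rewrite ltW// (lt_trans TT)|left].
- by apply: nearW => s; rewrite -w1t3; ring.
- have c0 : 0 < w2 / (2 * b) by rewrite divr_gt0// mulr_gt0.
  have nl : \forall s \near t3^'-, t1 < s < t3.
    apply: (near_leftI (d := t3 - t1)); first by rewrite subr_gt0.
    by move=> s; rewrite subKr.
  have := floor_near_left_int c0 xE; move: nl; apply: filterS2 => s /andP[s1 s3] fE.
  rewrite /arm_angle2 impacts_inside ?ltW// fE /y0; field; by rewrite gt_eqF.
- by rewrite cos_2piB.
- by [].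
- move=> t /andP[t0 tt]; rewrite add0r; apply: not_Sigma1_turn.
  by rewrite mulr_gt0//= mulrC -ltr_pdivlMr// (lt_trans tt).
Qed.

(** By determinism, the earlier of two first returns would be an intermediate
    return of the other. *)
Lemma first_return_unique (Sigma : set (phase R)) z z' z'' :
  first_return S Sigma z z' -> first_return S Sigma z z'' -> z' = z''.
Proof.
have main T T' c c' : 0 < T -> T <= T' -> trajectory S T c -> trajectory S T' c' ->
    c 0 = c' 0 -> c T = c' T.
  move=> T0 TT tc tc' c0.
  have tr := trajectory_restrict TT tc'.
  by apply: (step_trajectory_unique w1_gt0 w2_gt0 e1_gt e2_gt tc tr c0); rewrite lexx ltW.
move=> [T [c [T0 tc [c0 _] [cT ST] nc]]] [T' [c' [T0' tc' [c0' _] [cT' ST'] nc']]].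
have cc : c 0 = c' 0 by rewrite c0 c0'.
have [TT|TT|TE] := ltrgtP T T'.
- case: (nc' T); first by rewrite T0.
  by rewrite -(main T T' c c' T0 (ltW TT) tc tc' cc) cT.
- case: (nc T'); first by rewrite T0'.
  by rewrite -(main T' T c' c T0' (ltW TT) tc' tc (esym cc)) cT'.
- by rewrite -cT -cT' (main T T' c c' T0 _ tc tc' cc) ?TE.
Qed.

End Return.

(** * The interval exchange on the circle *)

Section Circle.
Variable R : realType.
Implicit Types (x y l v : R).

Lemma eq2pi_refl x : eq2pi x x.
Proof. by exists 0; rewrite mulr0 addr0. Qed.

Lemma eq2pi_sym x y : eq2pi x y -> eq2pi y x.
Proof. by move=> [k ->]; exists (- k); rewrite mulrNz; ring. Qed.

Lemma eq2pi_trans x y z : eq2pi x y -> eq2pi y z -> eq2pi x z.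
Proof. by move=> [k ->] [m ->]; exists (k + m); rewrite intrD; ring. Qed.

Lemma eq2pi_addr x y c : eq2pi x y -> eq2pi (x + c) (y + c).
Proof. by move=> [k ->]; exists k; ring. Qed.

Let pi2_gt0 : 0 < 2 * pi :> R. Proof. by rewrite mulr_gt0// pi_gt0. Qed.

Lemma eq2pi_small x y l : eq2pi x y -> l <= x < l + 2 * pi -> l <= y < l + 2 * pi ->
  x = y.
Proof.
move=> [k ->] /andP[x0 x1] /andP[y0 y1].
have h1 : 2 * pi * k%:~R < 2 * pi * 1%:~R :> R by rewrite mulr1; lra.
have h2 : 2 * pi * (-1)%:~R < 2 * pi * k%:~R :> R by rewrite mulrNz mulrN mulr1; lra.
move: h1 h2; rewrite !(ltr_pM2l pi2_gt0) !ltr_int => h1 h2.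
have -> : k = 0 by lia.
by rewrite mulr0 addr0.
Qed.

(** The representative of [x] modulo 2 pi in [[l, l + 2 pi[[. *)
Definition window l x : R := x + 2 * pi * (- Num.floor ((x - l) / (2 * pi)))%:~R.

Lemma window_eq l x : eq2pi x (window l x).
Proof. by exists (- Num.floor ((x - l) / (2 * pi))). Qed.

Lemma window_itv l x : l <= window l x < l + 2 * pi.
Proof.
have /andP[] := floor_itv ((x - l) / (2 * pi)); rewrite /window mulrNz.
set n := (Num.floor _)%:~R; rewrite intrD -/n ler_pdivlMr// ltr_pdivrMr// => h1 h2.
by apply/andP; split; lra.
Qed.

Lemma window_uniq l x y : eq2pi x y -> l <= y < l + 2 * pi -> window l x = y.
Proof.
move=> xy yI; apply: (eq2pi_small (l := l)) => //; last exact: window_itv.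
exact: eq2pi_trans (eq2pi_sym (window_eq l x)) xy.
Qed.

Lemma window_congr l x y : eq2pi x y -> window l x = window l y.
Proof.
move=> xy; apply: window_uniq (window_itv l y).
exact: eq2pi_trans xy (window_eq l y).
Qed.

Lemma arc_window l0 l len x : l0 <= l -> l + len <= l0 + 2 * pi ->
  Defs.arc l len x <-> l <= window l0 x < l + len.
Proof.
move=> l0l ll; split=> [[y xy /andP[y0 y1]]|wI]; last first.
  by exists (window l0 x) => //; exact: window_eq.
by rewrite (window_uniq (y := y))// ?y0 ?y1// (le_trans l0l y0) (lt_le_trans y1 ll).
Qed.

Lemma cos_sin_eq2pi x y : eq2pi x y -> cos x = cos y /\ sin x = sin y.
Proof.
have key x' (n : nat) : cos (x' + 2 * pi * n%:R) = cos x' /\ sin (x' + 2 * pi * n%:R) = sin x'.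
  elim: n => [|n [IHc IHs]]; first by rewrite mulr0 addr0.
  have -> : x' + 2 * pi * n.+1%:R = x' + 2 * pi * n%:R + pi *+ 2.
    by rewrite -natr1 -[pi *+ 2]mulr_natl; ring.
  by rewrite cosD2pi sinD2pi.
move=> [[n|n] ->]; first by have [-> ->] := key x n.
have [c s] := key (x + 2 * pi * (Negz n)%:~R) n.+1.
have E : x + 2 * pi * (Negz n)%:~R + 2 * pi * n.+1%:R = x by rewrite NegzE mulrNz; ring.
by rewrite E in c s; rewrite c s.
Qed.

Lemma cos_eq1 x : cos x = 1 -> eq2pi x 0.
Proof.
move=> c1; have [cw _] := cos_sin_eq2pi (window_eq 0 x).
have pi0 := pi_gt0 R.
have /andP[w0 w2] := window_itv 0 x; rewrite add0r in w2.
suff E : window 0 x = 0 by have := window_eq 0 x; rewrite E.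
have [wpi|wpi] := leP (window 0 x) pi.
  by apply: cos_inj; rewrite ?in_itv/= ?lexx ?w0 ?(ltW pi0)// -cw c1 cos0.
have : 2 * pi - window 0 x = 0; last by lra.
apply: cos_inj; rewrite ?in_itv/= ?lexx ?(ltW pi0)//.
  by apply/andP; split; lra.
by rewrite cos_2piB -cw c1 cos0.
Qed.

Lemma eq2pi_cos_sin x y : cos x = cos y -> sin x = sin y -> eq2pi x y.
Proof.
move=> c s; have /cos_eq1[k] : cos (x - y) = 1.
  by rewrite cosB c s -!expr2 cos2Dsin2.
by move=> h; exists k; lra.
Qed.

End Circle.

Section Exchange.
Variable R : realType.
Variables (thw Th chi : R).
Hypotheses (thw_itv : 0 < thw < pi).

Let f := fracpart chi.
Let K := Num.floor chi.
Let l0 := J_start thw Th.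
Let A : R := 2 * pi - 2 * thw.
Let B : R := 2 * thw * (1 - f).
Let C : R := 2 * thw * f.

Lemma fracpart_itv (x : R) : 0 <= fracpart x < 1.
Proof.
by rewrite /fracpart subr_ge0 floor_le ltrBlDl /=; have := floorD1_gt x; rewrite intrD.
Qed.

Lemma exchange_lengths : [/\ 0 < A, 0 < B, 0 <= C & A + B + C = 2 * pi].
Proof.
have /andP[t0 tpi] := thw_itv; have /andP[f0 f1] := fracpart_itv chi; rewrite -/f in f0 f1.
split.
- by rewrite /A; lra.
- by rewrite /B mulr_gt0 ?mulr_gt0// subr_gt0.
- by rewrite /C mulr_ge0// mulr_ge0// ltW.
- by rewrite /A /B /C; ring.
Qed.

(** The three arcs, of lengths [A], [B], [C], are put back in the order [A], [C],
    [B] and rotated by [Th]. *)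
Definition exchange_window v : R :=
  if v < l0 + A then v + Th
  else if v < l0 + A + B then v + Th + C else v + Th - B.

Lemma arc_left1 : arc_left l0 (J_lengths thw chi) 1 = l0 + A.
Proof. by rewrite /arc_left /J_lengths /= big_seq1. Qed.

Lemma arc_left0 : arc_left l0 (J_lengths thw chi) 0 = l0.
Proof. by rewrite /arc_left /= big_nil addr0. Qed.

Lemma arc_left2 : arc_left l0 (J_lengths thw chi) 2 = l0 + A + B.
Proof. by rewrite /arc_left /J_lengths /= big_cons big_seq1 addrA. Qed.

Lemma J_arcP x : 
  [/\ J_arc thw Th chi 0 x <-> window l0 x < l0 + A,
      J_arc thw Th chi 1 x <-> l0 + A <= window l0 x < l0 + A + B &
      J_arc thw Th chi 2 x <-> l0 + A + B <= window l0 x].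
Proof.
have [A0 B0 C0 ABC] := exchange_lengths.
have /andP[w0 w1] := window_itv l0 x.
rewrite /J_arc /nth_arc arc_left0 arc_left1 arc_left2 /= -/f -/A -/B -/C.
split.
- rewrite (arc_window (l0 := l0))//; last by lra.
  by rewrite w0.
- by rewrite (arc_window (l0 := l0))//; lra.
- rewrite (arc_window (l0 := l0)); [|lra|lra].
  by split=> [/andP[]//|->]; lra.
Qed.

Lemma exchange_map_window x :
  eq2pi (exchange_map thw Th chi x) (exchange_window (window l0 x)).
Proof.
have [J0 J1 _] := J_arcP x.
have xw := window_eq l0 x.
have /andP[w0 w1] := window_itv l0 x.
rewrite /exchange_map (asbool_equiv_eq J0) (asbool_equiv_eq J1) /exchange_window.
case: asboolP => [->|/negP]; first exact: eq2pi_addr.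
move=> /negbTE h; rewrite h; have {}h : l0 + A <= window l0 x by rewrite leNgt h.
rewrite h; case: asboolP => [/= h'|/= /negP/negbTE h'].
  rewrite h'; have [k E] := eq2pi_addr (Th + C) xw.
  (* the branch differs from the exchange on the window by whole turns only *)
  exists (k - K); have -> : window l0 x + Th + C = window l0 x + (Th + C) by ring.
  rewrite E intrD mulrNz /C -/f -/K; ring.
rewrite h'; have [k E] := eq2pi_addr (Th - B) xw.
exists (k - (K + 1)); have -> : window l0 x + Th - B = window l0 x + (Th - B) by ring.
rewrite E !(intrD, mulrNz) /B -/f -/K; ring.
Qed.

Lemma exchange_window_itv v : l0 <= v < l0 + 2 * pi ->
  l0 + Th <= exchange_window v < l0 + Th + 2 * pi.
Proof.
have [A0 B0 C0 ABC] := exchange_lengths; rewrite /exchange_window => /andP[v0 v1].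
case: (ltP v (l0 + A)) => h1; last case: (ltP v (l0 + A + B)) => h2;
  apply/andP; split; lra.
Qed.

Lemma exchange_window_inj u v : l0 <= u < l0 + 2 * pi -> l0 <= v < l0 + 2 * pi ->
  exchange_window u = exchange_window v -> u = v.
Proof.
have [A0 B0 C0 ABC] := exchange_lengths; rewrite /exchange_window => /andP[u0 u1] /andP[v0 v1].
case: (ltP u) => h1; last case: (ltP u) => h2;
  (case: (ltP v) => h3; last case: (ltP v) => h4); lra.
Qed.

Lemma exchange_window_surj y : l0 + Th <= y < l0 + Th + 2 * pi ->
  exists2 v, l0 <= v < l0 + 2 * pi & exchange_window v = y.
Proof.
have [A0 B0 C0 ABC] := exchange_lengths => /andP[y0 y1].
have [h1|h1] := ltP y (l0 + Th + A).
  exists (y - Th); first by apply/andP; split; lra.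
  by rewrite /exchange_window ifT; lra.
have [h2|h2] := ltP y (l0 + Th + A + C).
  exists (y - Th + B); first by apply/andP; split; lra.
  rewrite /exchange_window ifF; last by apply/negbTE; rewrite -leNgt; lra.
  rewrite ifF; last by apply/negbTE; rewrite -leNgt; lra.
  by lra.
exists (y - Th - C); first by apply/andP; split; lra.
rewrite /exchange_window ifF; last by apply/negbTE; rewrite -leNgt; lra.
by rewrite ifT; lra.
Qed.

Lemma exchange_map_interval_exchange :
  interval_exchange (J_start thw Th) (J_lengths thw chi) (exchange_map thw Th chi).
Proof.
have [A0 B0 C0 ABC] := exchange_lengths.
rewrite -/l0; split.
- split.
    by move=> len; rewrite !inE => /or3P[]/eqP->; rewrite // ltW.
  by rewrite /J_lengths !big_cons big_nil addr0 addrA.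
- move=> x y; split=> [xy|FF].
    apply: eq2pi_trans (exchange_map_window x) _.
    rewrite (window_congr l0 xy); exact: eq2pi_sym (exchange_map_window y).
  have : exchange_window (window l0 x) = exchange_window (window l0 y).
    apply: (@eq2pi_small _ _ _ (l0 + Th)).
    - apply: eq2pi_trans (eq2pi_sym (exchange_map_window x)) _.
      exact: eq2pi_trans FF (exchange_map_window y).
    - exact: exchange_window_itv (window_itv _ _).
    - exact: exchange_window_itv (window_itv _ _).
  move=> /(exchange_window_inj (window_itv _ _) (window_itv _ _)) E.
  apply: eq2pi_trans (window_eq l0 x) _; rewrite E; exact: eq2pi_sym (window_eq l0 y).
- move=> y; have [v vI vE] := exchange_window_surj (window_itv (l0 + Th) y).
  exists v; apply: eq2pi_trans (exchange_map_window v) _.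
  rewrite (window_uniq (eq2pi_refl v) vI) vE; exact: eq2pi_sym (window_eq _ y).
- case=> [|[|[|//]]] _; rewrite -/(J_arc thw Th chi _).
  + exists Th => x xJ; rewrite /exchange_map asboolT//; exact: eq2pi_refl.
  + exists (Th + 2 * thw * fracpart chi + 2 * pi * (Num.floor chi)%:~R) => x xJ.
    have [J0 J1 _] := J_arcP x.
    rewrite /exchange_map asboolF; last by move: xJ => /J1/andP[+ _] /J0; rewrite leNgt => /negP.
    rewrite asboolT// !addrA; exact: eq2pi_refl.
  + exists (Th + 2 * thw * (-1 + fracpart chi) + 2 * pi * (Num.floor chi + 1)%:~R) => x xJ.
    have [J0 J1 J2] := J_arcP x; move: xJ => /J2 xJ.
    rewrite /exchange_map asboolF; last by move=> /J0; lra.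
    rewrite asboolF; last by move=> /J1/andP[_]; lra.
    rewrite !addrA; exact: eq2pi_refl.
Qed.

(** The end points are their own representatives, except the third one when [C]
    vanishes: l0 + A + B is then l0 + 2 pi, represented by [l0]. *)
Lemma J_endpointsP x : J_endpoints thw Th chi x <->
  [\/ window l0 x = l0, window l0 x = l0 + A | window l0 x = l0 + A + B].
Proof.
have [A0 B0 C0 ABC] := exchange_lengths.
split.
  move=> [[|[|[|//]]] _]; rewrite ?arc_left0 ?arc_left1 ?arc_left2 => xe.
  - by apply: Or31; apply: window_uniq => //; apply/andP; split; lra.
  - by apply: Or32; apply: window_uniq => //; apply/andP; split; lra.
  - have [C1|C1] := eqVneq C 0.
      apply: Or31; apply: window_uniq; last by apply/andP; split; lra.
      by apply: eq2pi_trans xe _; exists (-1); rewrite mulrNz; lra.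
    have C2 : 0 < C by rewrite lt_neqAle eq_sym C1.
    by apply: Or33; apply: window_uniq => //; apply/andP; split; lra.
have xw := window_eq l0 x.
case=> E; rewrite E in xw.
- by exists 0%N => //; rewrite arc_left0.
- by exists 1%N => //; rewrite arc_left1.
- by exists 2%N => //; rewrite arc_left2.
Qed.

End Exchange.

(** * The return map *)

Section ReturnMap.
Variable R : realType.
Variables (w1 w2 q1w q2w e1 e2 : R).
Hypotheses (w1_gt0 : 0 < w1) (w2_gt0 : 0 < w2).
Hypotheses (e1_gt : hstep w1 q1w < e1) (e2_gt : hstep w2 q2w < e2).
Let S := step_system w1 w2 q1w q2w e1 e2.
Let a := theta_wall w1 e1 q1w.
Let b := theta_wall w2 e2 q2w.
Let P := angle_phase w1 w2 e1 e2.
Let Th := 2 * (w2 / w1) * a.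
Let chi := w2 / w1 * ((pi - a) / b).
Let l0 := J_start b Th.

Let a_gt0 : 0 < a. Proof. by have /andP[] := theta_wall_itv e1_gt. Qed.
Let bI : 0 < b < pi. Proof. exact: (theta_wall_itv e2_gt). Qed.
Let b_gt0 : 0 < b. Proof. by have /andP[] := bI. Qed.

Lemma angle_phase_eq2pi (x y : R) : eq2pi x y <-> P 0 x = P 0 y.
Proof.
have E0 : Num.sqrt (2 * e2) != 0.
  by rewrite gt_eqF// sqrtr_gt0 mulr_gt0// (energy_gt0 e2_gt).
split=> [/cos_sin_eq2pi[c s]|[c /eqP]]; first by rewrite /P /angle_phase c s.
rewrite eqr_opp => /eqP/(mulfI E0) s; apply: eq2pi_cos_sin s.
by apply: (mulfI _ c); rewrite mulf_neq0// invr_eq0 gt_eqF.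
Qed.

Lemma Sigma1_phase z x : level S z -> Sigma1 w1 z -> is_angle w2 e2 z.1.2 z.2.2 x ->
  z = P 0 x.
Proof.
case: z => -[q1 q2] [p1 p2] [_ /= h1 _] [/= p10]; rewrite oscillator_force oppr_lt0.
rewrite pmulr_rgt0 ?exprn_gt0// => q10 [-> ->]; rewrite p10 in h1 *.
have e10 := energy_gt0 e1_gt.
rewrite /P /angle_phase cos0 sin0 mulr1 mulr0 oppr0.
suff -> : q1 = Num.sqrt (2 * e1) / w1 by [].
move: h1; rewrite /oscillatorH /oscillatorV expr0n/= mul0r add0r => h1.
rewrite (_ : 2 * e1 = (w1 * q1) ^+ 2); last by rewrite -h1 exprMn; field.
by rewrite sqrtr_sqr gtr0_norm ?mulr_gt0//; field; rewrite gt_eqF.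
Qed.

Lemma Sigma1_return_phase (x x' : R) :
  Sigma1_return w1 w2 q1w q2w e1 e2 x x' <->
  first_return S (Sigma1 w1) (P 0 x) (P 0 x').
Proof.
split=> [[z [z' [fr zx zx']]]|fr]; last by exists (P 0 x), (P 0 x').
have [T [c [T0 tc [c0 s0] [cT sT] _]]] := fr.
have [lc _ _ _] := tc.
have l0' : level S z by rewrite -c0; apply: lc; rewrite lexx ltW.
have lT : level S z' by rewrite -cT; apply: lc; rewrite lexx ltW.
by rewrite -(Sigma1_phase l0' s0 zx) -(Sigma1_phase lT sT zx').
Qed.

Let A : R := 2 * pi - 2 * b.
Let B : R := 2 * b * (1 - fracpart chi).
Let C : R := 2 * b * fracpart chi.

(** With y = v + Th / 2, the arc [A] is the range b < y < 2 pi - b of reflected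
    trajectories; on the other two y - 2 pi lies in ]- b, b[ and the trajectory
    goes through the arm, with [K] impacts on [B] and [K + 1] on [C]. *)
Lemma return_on_window (v : R) : l0 <= v < l0 + 2 * pi ->
  if [|| v == l0, v == l0 + A | v == l0 + A + B]
  then forall z', ~ first_return S (Sigma1 w1) (P 0 v) z'
  else first_return S (Sigma1 w1) (P 0 v) (P 0 (exchange_window b Th chi v)).
Proof.
move=> /andP[v0 v1].
have [A0 B0 C0 ABC] := exchange_lengths chi bI; rewrite -/A -/B -/C in A0 B0 C0 ABC.
have w10 : w1 != 0 by rewrite gt_eqF.
have b0 : b != 0 by rewrite gt_eqF.
have ThE : Th = 2 * (w2 * (a / w1)) by rewrite /Th; field.
have l0E : l0 = b - w2 * (a / w1) by rewrite /l0 /J_start ThE; field.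
have bp := b_gt0.
have AE : A = 2 * pi - 2 * b by [].
have BE : B = 2 * b - C by rewrite /B /C; ring.
have CE : C = 2 * b * fracpart chi by [].
have chiE : w2 * ((2 * pi - a) / w1 - a / w1) = 2 * b * chi by rewrite /chi; field; rewrite b0.
have [vE|vl0] := eqVneq v l0 => /=.
  move=> z'; have := no_return_entry w1_gt0 w2_gt0 e1_gt e2_gt (y := b) (z' := z')
    (or_introl erefl).
  by rewrite vE l0E.
have {vl0 v0}v0 : l0 < v by rewrite lt_neqAle eq_sym vl0.
have [vE|vA] := eqVneq v (l0 + A) => /=.
  move=> z'; have := no_return_entry w1_gt0 w2_gt0 e1_gt e2_gt (y := - b) (z' := z')
    (or_intror erefl).
  suff E : P 0 (- b - w2 * (a / w1)) = P 0 v by rewrite -E.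
  by apply/angle_phase_eq2pi; exists 1; rewrite vE l0E AE; ring.
have [vlA|vlA] := ltP v (l0 + A).
  have -> : v == l0 + A + B = false by apply/negbTE; rewrite lt_eqF//; lra.
  have yI : b < v + w2 * (a / w1) < 2 * pi - b.
    by apply/andP; split; move: v0 vlA; rewrite l0E AE; lra.
  rewrite /exchange_window -/l0 -/A vlA.
  have -> : v + Th = v + w2 * (a / w1) + w2 * (a / w1) by rewrite ThE; ring.
  rewrite -[X in first_return _ _ (P 0 X)](addrK (w2 * (a / w1)) v).
  exact: (first_return_reflected w1_gt0 w2_gt0 e1_gt e2_gt yI).
have {vA vlA}vlA : l0 + A < v by rewrite lt_neqAle eq_sym vA.
(* the angle at the entrance of the arm, brought back to ]- b, b[ by a full turn *)
pose y := v + w2 * (a / w1) - 2 * pi.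
have yI : - b < y < b.
  by apply/andP; split; move: vlA v1; rewrite /y l0E AE; lra.
have y0E : P 0 (y - w2 * (a / w1)) = P 0 v.
  by apply/angle_phase_eq2pi; exists 1; rewrite /y; ring.
(* the laps made on the circle of length 2 b when leaving the arm *)
set x := w2 / (2 * b) * ((2 * pi - a) / w1) + (y + b - w2 * (a / w1)) / (2 * b).
have xE : 2 * b * x = y + b + 2 * b * chi by rewrite -chiE /x; field; rewrite w10 b0.
have b2 : 0 < 2 * b by rewrite mulr_gt0.
set K := Num.floor chi.
have CK : 2 * b * chi = 2 * b * K%:~R + C by rewrite CE /fracpart -/K; ring.
have /andP[yb yb'] := yI.
have finalE (n : int) : y - w2 * (a / w1) + w2 * (2 * pi / w1) - 2 * b * n%:~R =
    y + w2 * (a / w1) + 2 * b * K%:~R + C - 2 * b * n%:~R.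
  rewrite -[_ + 2 * b * K%:~R + C]addrA -CK -chiE; by field.
have [vE|vB] := eqVneq v (l0 + A + B).
  have yE : y = b - C by rewrite /y vE l0E AE BE; ring.
  have xK : x = (K + 1)%:~R.
    apply: (mulfI (lt0r_neq0 b2)); rewrite xE CK yE intrD; ring.
  move=> z'; rewrite -y0E; apply: (no_return_exit w1_gt0 w2_gt0 e1_gt e2_gt yI).
  by rewrite -/x xK intrKfloor.
have fr : (Num.floor x)%:~R != x -> first_return S (Sigma1 w1) (P 0 (y - w2 * (a / w1)))
    (P 0 (y - w2 * (a / w1) + w2 * (2 * pi / w1) - 2 * b * (Num.floor x)%:~R)).
  exact: (first_return_through_arm w1_gt0 w2_gt0 e1_gt e2_gt yI).
move: fr; rewrite finalE y0E /exchange_window -/l0 -/A -/B -/C ltNge (ltW vlA)/=.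
have [vlB|vlB] := ltP v (l0 + A + B).
  have yC : y + b + C < 2 * b * 1.
    by move: vlB; rewrite /y l0E AE BE; lra.
  have fx : Num.floor x = K.
    apply: floor_def; rewrite -(ler_pM2l b2) -(ltr_pM2l b2) xE CK intrD.
    by apply/andP; split; lra.
  have xn : (Num.floor x)%:~R != x.
    rewrite fx; apply/eqP => xK; have := xE; rewrite -xK CK; lra.
  move=> /(_ xn); rewrite fx.
  suff -> : P 0 (y + w2 * (a / w1) + 2 * b * K%:~R + C - 2 * b * K%:~R) = P 0 (v + Th + C) by [].
  by apply/angle_phase_eq2pi; exists 1; rewrite ThE /y; ring.
have {vB vlB}vlB : l0 + A + B < v by rewrite lt_neqAle eq_sym vB.
have yC : 2 * b * 1 < y + b + C.
  by move: vlB; rewrite /y l0E AE BE; lra.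
have fracC : C < 2 * b.
  by rewrite CE gtr_pMr//; have /andP[] := fracpart_itv chi.
have fx : Num.floor x = K + 1.
  apply: floor_def; rewrite -(ler_pM2l b2) -(ltr_pM2l b2) xE CK !intrD.
  by apply/andP; split; lra.
have xn : (Num.floor x)%:~R != x.
  rewrite fx; apply/eqP => xK; have := xE; rewrite -xK CK intrD; lra.
move=> /(_ xn); rewrite fx.
suff -> : P 0 (y + w2 * (a / w1) + 2 * b * K%:~R + C - 2 * b * (K + 1)%:~R) =
  P 0 (v + Th - B) by [].
by apply/angle_phase_eq2pi; exists 1; rewrite ThE /y BE intrD; ring.
Qed.

Lemma Sigma1_returnP (x x' : R) :
  Sigma1_return w1 w2 q1w q2w e1 e2 x x' <->
  ~ J_endpoints b Th chi x /\ eq2pi (exchange_map b Th chi x) x'.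
Proof.
rewrite Sigma1_return_phase (J_endpointsP _ _ bI) -/l0 -/A -/B.
have vI := window_itv l0 x; have := return_on_window vI.
have xv : P 0 x = P 0 (window l0 x) by apply/angle_phase_eq2pi; exact: window_eq.
rewrite xv; case: ifPn => [ep nr|nep fr].
  split=> [/nr//|[nend _]]; case: nend.
  by case/or3P: ep => /eqP; [exact: Or31|exact: Or32|exact: Or33].
have FE := exchange_map_window Th chi bI x.
split=> [fr'|[_ Fx]].
  split.
    by case=> E; move: nep; rewrite E eqxx ?orbT.
  have := first_return_unique w1_gt0 w2_gt0 e1_gt e2_gt fr fr'.
  by move=> /angle_phase_eq2pi; exact: eq2pi_trans FE.
suff <- : P 0 (exchange_window b Th chi (window l0 x)) = P 0 x' by [].
by apply/angle_phase_eq2pi; exact: eq2pi_trans (eq2pi_sym FE) Fx.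
Qed.

End ReturnMap.

Theorem theorem2p6 (R : realType) (w1 w2 q1wall q2wall h : R)
    (w1_gt0 : 0 < w1) (w2_gt0 : 0 < w2) (qwall_neq0 : q1wall * q2wall != 0)
    (h_gt : (w1 ^+ 2 * q1wall ^+ 2 + w2 ^+ 2 * q2wall ^+ 2) / 2 < h) :
  [/\ forall e1, Rc w1 w2 q1wall q2wall h (e1, h - e1) ->
        let a := theta_wall w1 e1 q1wall in
        let b := theta_wall w2 (h - e1) q2wall in
        [/\ 0 < a < pi, 0 < b < pi &
            topologically_conjugated
              (@flow R (step_system w1 w2 q1wall q2wall e1 (h - e1)))
              (@flow R (L_billiard pi pi a b w1 w2))],
      [/\ forall w, w = w1 \/ w = w2 ->
            [/\ smooth_on [set u | hstep w u.2 < u.1]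
                  (fun u => theta_wall w u.1 u.2),
                forall q, q != 0 ->
                  monotone_on [set e | hstep w q < e]
                    (fun e => theta_wall w e q) &
                forall e,
                  monotone_on [set q | hstep w q < e]
                    (fun q => theta_wall w e q)] &
          opposite_monotonicity_on
            [set e1 | Rc w1 w2 q1wall q2wall h (e1, h - e1)]
            (fun e1 => theta_wall w1 e1 q1wall)
            (fun e1 => theta_wall w2 (h - e1) q2wall)
          <-> 0 < q1wall * q2wall] &
      forall e1, Rc w1 w2 q1wall q2wall h (e1, h - e1) ->
        let thw := theta_wall w2 (h - e1) q2wall in
        let Th := Theta2 w1 w2 q1wall e1 in
        let chi := chi2 w1 w2 q1wall q2wall e1 h in
        let F := exchange_map thw Th chi in
        interval_exchange (J_start thw Th) (J_lengths thw chi) F /\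
        forall theta theta',
          Sigma1_return w1 w2 q1wall q2wall e1 (h - e1) theta theta' <->
          ~ J_endpoints thw Th chi theta /\ eq2pi (F theta) theta'].
Proof.
have rc e1 : Rc w1 w2 q1wall q2wall h (e1, h - e1) ->
    hstep w1 q1wall < e1 /\ hstep w2 q2wall < h - e1.
  by move=> [/= /andP[h1 h2] _]; split=> //; lra.
split.
- move=> e1 /rc[h1 h2]; split; [exact: theta_wall_itv|exact: theta_wall_itv|].
  exact: step_billiard_conjugacy.
- split.
    move=> w ww; have w0 : 0 < w by case: ww => ->.
    split.
    + exact: theta_wall_smooth.
    + move=> q; rewrite neq_lt => /orP[q0|q0].
        by right; exact: theta_wall_decreasing.
      by left; exact: theta_wall_increasing.
    + by move=> e; right; exact: theta_wall_decreasing_wall.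
  apply: opposite_monotonicity_walls => //.
  by move: h_gt; rewrite /hstep /oscillatorV; lra.
- move=> e1 /rc[h1 h2]; split.
    by apply: exchange_map_interval_exchange; exact: theta_wall_itv.
  by move=> theta theta'; exact: Sigma1_returnP.
Qed.
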